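(* Let $d\ge 2$ and $k\ge 1$ be constant integers ($d,k=\Theta(1)$), let $L>0$, $\Delta\ge 0$, and let $\varepsilon>0$. There is a deterministic algorithm that finds an $\varepsilon$-stationary point of $f$ within $k$ rounds of parallel function-value queries, issuing <br>(1) in the unconstrained case ($f:\mathbb{R}^d\to\mathbb{R}$), at most $$C_1(d,k,L,\Delta)\cdot \varepsilon^{-\frac{d-1}{\left(\frac{2d}{d+1}\right)^k-1}-(d-1)}$$ queries per round; <br>(2) in the constrained case ($f$ constrained on $[0,1]^d$), at most $$C_2(d,k,L)\cdot\varepsilon^{-\frac{d-1}{2\left(\left(\frac{2d}{d+1}\right)^k-1\right)}-\frac{d-1}{2}}$$ queries per round. <br>Here $C_1(d,k,L,\Delta)$ and $C_2(d,k,L)$ are constants depending only on $d,k,L,\Delta$ and on $d,k,L$ respectively.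
   Context: The function $f$ is differentiable with $L$-Lipschitz gradient (Euclidean norm) and is accessed through an oracle returning the value $f(\boldsymbol{x})$ at a queried point $\boldsymbol{x}$. An algorithm runs in rounds: in each round it submits a finite batch of query points in parallel, which may depend only on the answers received in previous rounds; after $k$ rounds it outputs a point. In the unconstrained case the algorithm is given an initial point $\boldsymbol{x}^0$ with $f(\boldsymbol{x}^0)-\inf_{\boldsymbol{x}}f(\boldsymbol{x})\le\Delta$ (and $f$ may be normalized to take values in $[0,\infty)$), and an $\varepsilon$-stationary point is a point $\boldsymbol{x}\in\mathbb{R}^d$ with $\|\nabla f(\boldsymbol{x})\|\le\varepsilon$. In the constrained case an $\varepsilon$-stationary point (also called an $\varepsilon$-KKT point) is a point $\boldsymbol{x}\in[0,1]^d$ with $\|g(\boldsymbol{x})\|\le\varepsilon$, where the projected gradient $g$ is given coordinatewise by $g_i(\boldsymbol{x})=\min\{0,[\nabla f(\boldsymbol{x})]_i\}$ if $x_i=0$, $g_i(\boldsymbol{x})=[\nabla f(\boldsymbol{x})]_i$ if $x_i\in(0,1)$, and $g_i(\boldsymbol{x})=\max\{0,[\nabla f(\boldsymbol{x})]_i\}$ if $x_i=1$.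
   Formalization: In the constrained case (2) the bound is C_2·max(1, ε^{-p}), with p the stated exponent, instead of C_2·ε^{-p}: for large ε the latter is below 1, allows no query and fails for f = ±M·x_1 with M > ε; for ε ≤ 1 the two coincide. *)

(* Defs.v *)
From HB Require Import structures.
From mathcomp Require Import all_boot all_order all_algebra.
From mathcomp Require Import all_classical all_reals all_analysis.

Set Implicit Arguments.
Unset Strict Implicit.
Unset Printing Implicit Defensive.

Import Order.TTheory GRing.Theory Num.Theory.
Import numFieldNormedType.Exports.

Local Open Scope classical_set_scope.
Local Open Scope ring_scope.

Definition dot (R : realType) (d : nat) (u v : 'rV[R]_d) : R :=
  \sum_(i < d) u 0 i * v 0 i.

(* The canonical norm [`|v|] on ['rV[R]_d] is the sup norm. *)
Definition enorm (R : realType) (d : nat) (v : 'rV[R]_d) : R :=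
  Num.sqrt (\sum_(i < d) v 0 i ^+ 2).

Definition grad (R : realType) (d : nat) (f : 'rV[R]_d -> R) (x : 'rV[R]_d) :
  'rV[R]_d := \row_(i < d) 'D_(delta_mx 0 i) f x.

Definition smooth (R : realType) (d : nat) (L : R) (f : 'rV[R]_d -> R) : Prop :=
  (forall x, differentiable f x) /\
  (forall x y, enorm (grad f x - grad f y) <= L * enorm (x - y)).

Definition unit_cube (R : realType) (d : nat) : set 'rV[R]_d :=
  [set x | forall i, 0 <= x 0 i <= 1].

(* [g] is the gradient at [x] of [f] restricted to [D]: only the values of [f]
   on [D] matter, so the derivatives are one-sided on the boundary of [D]. *)
Definition is_gradient_in (R : realType) (d : nat) (D : set 'rV[R]_d)
    (f : 'rV[R]_d -> R) (x g : 'rV[R]_d) : Prop :=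
  forall e : R, 0 < e ->
    \forall y \near x, D y -> `|f y - f x - dot g (y - x)| <= e * enorm (y - x).

(* [f : [0,1]^d -> R], represented by any extension to a total function, is
   differentiable with gradient [G], which is [L]-Lipschitz on [[0,1]^d]. *)
Definition smooth_on_cube (R : realType) (d : nat) (L : R)
    (f : 'rV[R]_d -> R) (G : 'rV[R]_d -> 'rV[R]_d) : Prop :=
  (forall x, unit_cube x -> is_gradient_in (@unit_cube R d) f x (G x)) /\
  (forall x y, unit_cube x -> unit_cube y ->
     enorm (G x - G y) <= L * enorm (x - y)).

Definition stationary (R : realType) (d : nat) (eps : R)
    (f : 'rV[R]_d -> R) (x : 'rV[R]_d) : Prop :=
  enorm (grad f x) <= eps.

(* [v] is the value of the gradient at [x]. *)
Definition proj_grad (R : realType) (d : nat) (x v : 'rV[R]_d) : 'rV[R]_d :=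
  \row_(i < d) if x 0 i == 0 then Num.min 0 (v 0 i)
               else if x 0 i == 1 then Num.max 0 (v 0 i)
               else v 0 i.

Definition kkt (R : realType) (d : nat) (eps : R)
    (G : 'rV[R]_d -> 'rV[R]_d) (x : 'rV[R]_d) : Prop :=
  unit_cube x /\ enorm (proj_grad x (G x)) <= eps.

(* A deterministic parallel algorithm sees a history, namely the list of the
   lists of answers of the past rounds, oldest round first.  The past queries
   need not be recorded since they are determined by the past answers. *)
Record algorithm (R : realType) (d : nat) := Algorithm {
  alg_batch : seq (seq R) -> seq 'rV[R]_d;
  alg_output : seq (seq R) -> 'rV[R]_d }.

Fixpoint answers (R : realType) (d : nat) (A : algorithm R d)
    (f : 'rV[R]_d -> R) (j : nat) : seq (seq R) :=
  if j is j'.+1 then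
    let h := answers A f j' in rcons h (map f (alg_batch A h))
  else [::].

(* The batch submitted after [j] completed rounds. *)
Definition batch (R : realType) (d : nat) (A : algorithm R d)
    (f : 'rV[R]_d -> R) (j : nat) : seq 'rV[R]_d :=
  alg_batch A (answers A f j).

Definition output (R : realType) (d : nat) (A : algorithm R d)
    (f : 'rV[R]_d -> R) (k : nat) : 'rV[R]_d :=
  alg_output A (answers A f k).

Section GradientConsistency.
Variables (R : realType) (d : nat).
Implicit Types (f : 'rV[R]_d -> R) (x v : 'rV[R]_d).

Lemma norm_le_enorm v : `|v| <= enorm v.
Proof.
rewrite /Num.norm /= mx_normrE; apply/bigmax_leP; split; first exact: sqrtr_ge0.
move=> [i j] _ /=; rewrite (ord1 i) -sqrtr_sqr; apply: ler_wsqrtr.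
by rewrite (bigD1 j) //= lerDl; apply: sumr_ge0 => k _; exact: sqr_ge0.
Qed.

Lemma diff_dot_grad f x v : differentiable f x -> 'd f x v = dot (grad f x) v.
Proof.
move=> df; rewrite {1}[v]row_sum_delta linear_sum; apply: eq_bigr => i _.
by rewrite linearZ /= mxE deriveE // mulrC.
Qed.

Lemma differentiable_is_gradient_in (D : set 'rV[R]_d) f x :
  differentiable f x -> is_gradient_in D f x (grad f x).
Proof.
move=> df e e0; have /eqaddoP/(_ e e0) := diff_locally df.
move=> dE; rewrite (near_shift 0 x); near=> h => _ /=.
have dEh : `|f (h + x) - (f x + 'd f x h)| <= e * `|h| by near: h.
rewrite subr0 addrK -diff_dot_grad // -addrA -opprD.
by apply: (le_trans dEh); rewrite ler_pM2l // norm_le_enorm.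
Unshelve. all: by end_near. Qed.

End GradientConsistency.

(* Main.v *)
Require Import Defs.
From mathcomp Require Import all_boot all_order all_algebra.
From mathcomp Require Import all_classical all_reals all_analysis.
From mathcomp Require Import ring lra.

Import Order.TTheory GRing.Theory Num.Theory.
Import numFieldNormedType.Exports.

Local Open Scope classical_set_scope.
Local Open Scope ring_scope.

Set Implicit Arguments.
Unset Strict Implicit.
Unset Printing Implicit Defensive.

(** Each round keeps a box Q that certifiably traps an almost stationary point,
    and shrinks it; the last round searches the remaining box on a full grid.

    The certificate is a point v of Q such that the current objective phi is
    larger than phi v, by a fixed slack, on the part of the boundary of Q that
    lies inside the cube.  A minimizer of phi over Q then avoids this boundary,
    hence is stationary for the cube.  To shrink Q, cut it into m^d cells and
    query phi at the points of a net drawn on the cutting hyperplanes, of mesh h.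
    Let v' be the best point among v and the net, and Q' the union of the cell
    of v' and its neighbours.  No value of phi on the boundary of Q' is below
    phi v' by more than O(h^2): from a point of a hyperplane, moving one
    coordinate at a time to a grid value, always in the direction where the
    partial derivative is nonpositive, costs only second-order terms
    ([round_to_grid]).  This first-order cancellation is why a mesh as coarse as
    the square root of delta times the cell size suffices, with delta the target
    accuracy.  The O(h^2) loss is repaid by a penalty, in the manner of Ekeland's
    principle: phi is replaced by phi + mu |x - v'|^2.  If s' is the size of a
    cell, v' is at distance at least s' from the new faces, so that the penalty
    adds mu s'^2 there, and mu of order delta / s' makes this exceed h^2 while
    changing the gradient on Q' by only O(delta) ([zoom_round]).  On the last
    grid, of mesh O(delta), the best point y is off the trapping boundary, and
    comparing it with its grid neighbours bounds every partial derivative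
    ([last_round]).

    Round i goes from size D_i to D_{i+1} and costs
    (D_i / D_{i+1}) (D_i / sqrt (delta D_{i+1}))^(d-1) queries.  Equal costs over
    the k rounds, with D_0 = 1 and D_k = delta, force
    D_i = delta^((r^i - 1) / (r^k - 1)) with r = 2d / (d + 1), and the common
    cost is the stated power of delta ([schedule_exists], [schedule_solvable]).

    All this is done on the unit cube, for functions that satisfy the quadratic
    upper bound [descent] with constant 1 ([cube_algorithm]).  The constrained
    case follows by dividing f by L.  In the unconstrained case the values of f
    exceed its infimum by at most Delta at x0, so that the penalty
    mu |x - x0|^2, with a gradient of order eps on a cube of radius of order
    Delta / eps about x0, already makes the boundary of that cube
    uncompetitive; rescaling this cube to the unit cube turns eps into a
    multiple of eps^2, whence the doubled exponent. *)

(** * Combining algorithms *)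

Section Algorithms.
Variables (R : realType) (d : nat).
Implicit Types (A : algorithm R d) (f : 'rV[R]_d -> R) (q : seq 'rV[R]_d).

Definition then_alg q (cont : seq R -> algorithm R d) : algorithm R d :=
  Algorithm (fun h => if h is a :: h' then alg_batch (cont a) h' else q)
            (fun h => if h is a :: h' then alg_output (cont a) h' else 0).

Lemma answers_then q cont f j :
  answers (then_alg q cont) f j.+1 = map f q :: answers (cont (map f q)) f j.
Proof. by elim: j => [//|j IH]; rewrite [LHS]/= -/(answers _ f j.+1) IH. Qed.

Lemma batch_thenS q cont f j :
  batch (then_alg q cont) f j.+1 = batch (cont (map f q)) f j.
Proof. by rewrite /batch answers_then. Qed.

Lemma output_thenS q cont f j :
  output (then_alg q cont) f j.+1 = output (cont (map f q)) f j.
Proof. by rewrite /output answers_then. Qed.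

(** The answers that [A] would have received about F, recomputed from the answers
    about f: the queries of [A] are themselves determined by earlier answers. *)
Definition replay A (T : 'rV[R]_d -> R -> R) (h : seq (seq R)) :=
  foldl (fun acc ans =>
           rcons acc [seq T p.1 p.2 | p <- zip (alg_batch A acc) ans]) [::] h.

(** Running [A] on F x = T x (f (psi x)) with queries to f only. *)
Definition simulate A (psi : 'rV[R]_d -> 'rV[R]_d) T : algorithm R d :=
  Algorithm (fun h => map psi (alg_batch A (replay A T h)))
            (fun h => psi (alg_output A (replay A T h))).

Lemma replay_answers A psi T f F j : (forall x, F x = T x (f (psi x))) ->
  replay A T (answers (simulate A psi T) f j) = answers A F j.
Proof.
move=> FE; elim: j => [//|j IH] /=.
rewrite /replay foldl_rcons -/(replay A T _) IH; congr (rcons _ _).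
by elim: (alg_batch A _) => //= x s ->; rewrite FE.
Qed.

Lemma batch_simulate A psi T f F j : (forall x, F x = T x (f (psi x))) ->
  batch (simulate A psi T) f j = map psi (batch A F j).
Proof. by move=> FE; rewrite /batch /= (replay_answers A j FE). Qed.

Lemma output_simulate A psi T f F j : (forall x, F x = T x (f (psi x))) ->
  output (simulate A psi T) f j = psi (output A F j).
Proof. by move=> FE; rewrite /output /= (replay_answers A j FE). Qed.

End Algorithms.

(** * Boxes, grids and rounding *)

Lemma argmin_seq (R : realType) (T : eqType) (F : T -> R) (q : seq T) (x0 : T) :
  x0 \in q -> exists2 x, x \in q & forall y, y \in q -> F x <= F y.
Proof.
elim: q x0 => // a [|b q] IH x0 _.
  by exists a; rewrite ?mem_head // => y; rewrite inE => /eqP ->.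
have [x xq xmin] := IH b (mem_head _ _).
have [ax|xa] := leP (F a) (F x).
  exists a; first exact: mem_head.
  by move=> y; rewrite inE => /orP[/eqP -> //|/xmin]; apply: le_trans.
exists x; first by rewrite inE xq orbT.
by move=> y; rewrite inE => /orP[/eqP ->|/xmin//]; exact: ltW.
Qed.

Section OneDim.
Variable R : realType.
Implicit Types (a w z v : R) (m M : nat).

Definition on_grid M a w z : Prop :=
  exists2 n : nat, (n <= M)%N & z = a + n%:R / M%:R * w.

Lemma on_grid_bracket M a w z : (0 < M)%N -> a <= z <= a + w ->
  exists2 n : nat, (n < M)%N &
    a + n%:R / M%:R * w <= z <= a + n.+1%:R / M%:R * w.
Proof.
move=> M0 /andP[az zw].
pose P n := (n < M)%N && (a + n%:R / M%:R * w <= z).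
have exP : exists n, P n by exists 0%N; rewrite /P M0 mul0r mul0r addr0.
have bP n : P n -> (n <= M)%N by case/andP=> /ltnW.
case: (ex_maxnP exP bP) => n /andP[nM nz] nmax.
exists n => //; rewrite nz /=.
have [nM1|] := ltnP n.+1 M.
  rewrite leNgt; apply/negP => /ltW zn.
  by have := nmax n.+1; rewrite /P nM1 zn ltnn => /(_ isT).
rewrite leq_eqVlt ltnNge nM orbF => /eqP Mn.
by rewrite -Mn divff ?mul1r // pnatr_eq0 -lt0n.
Qed.

Lemma on_grid_in M a w z : 0 <= w -> on_grid M a w z -> a <= z <= a + w.
Proof.
move=> w0 [n nM ->].
have [M0|M0] := posnP M.
  by rewrite M0 invr0 mulr0 mul0r addr0 lexx /= lerDl.
rewrite lerDl mulr_ge0 ?divr_ge0 //= lerD2l ler_piMl //.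
by rewrite ler_pdivrMr ?ltr0n // mul1r ler_nat.
Qed.

Lemma on_grid_next M a w z : (0 < M)%N -> on_grid M a w z -> z != a + w ->
  on_grid M a w (z + w / M%:R).
Proof.
move=> M0 [n nM zE] zw; have MR : M%:R != 0 :> R by rewrite pnatr_eq0 -lt0n.
have nM' : (n < M)%N.
  rewrite ltn_neqAle nM andbT; apply: contraNneq zw => nE.
  by rewrite zE nE divff // mul1r.
by exists n.+1 => //; rewrite zE -natr1; field.
Qed.

Lemma on_grid_prev M a w z : (0 < M)%N -> on_grid M a w z -> z != a ->
  on_grid M a w (z - w / M%:R).
Proof.
move=> M0 [[|n] nM zE] za; have MR : M%:R != 0 :> R by rewrite pnatr_eq0 -lt0n.
  by rewrite zE mul0r mul0r addr0 eqxx in za.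
by exists n; [exact: ltnW|rewrite zE -natr1; field].
Qed.

(** The union of the cell of v with its two neighbours, clipped to the interval:
    an endpoint is either an old one or a subdivision point at least one cell
    away from v. *)
Lemma zoom1 m a w v : (0 < m)%N -> 0 < w -> a <= v <= a + w ->
  exists p : R * R, [/\ a <= p.1 /\ p.1 + p.2 <= a + w,
    w / m%:R <= p.2 <= 3 * (w / m%:R),
    p.1 <= v <= p.1 + p.2,
    p.1 = a \/ (on_grid m a w p.1 /\ w / m%:R <= v - p.1) &
    p.1 + p.2 = a + w \/
      (on_grid m a w (p.1 + p.2) /\ w / m%:R <= p.1 + p.2 - v)].
Proof.
move=> m0 w0 avw; have [c cm /andP[cv vc]] := on_grid_bracket m0 avw.
have mR : m%:R != 0 :> R by rewrite pnatr_eq0 -lt0n.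
set u := w / m%:R.
have u0 : 0 < u by rewrite divr_gt0 // ltr0n.
have nE n : n%:R / m%:R * w = n%:R * u by rewrite /u mulrAC mulrA.
have wE : w = m%:R * u by rewrite /u mulrC divfK.
rewrite nE -natr1 mulrDl mul1r in vc; rewrite nE in cv.
(* subdivision indices of the endpoints of the union of cells *)
have [lo [lo0 lov lob]] : exists l : nat, [/\ (l <= c)%N, (c <= l.+1)%N &
    l = 0%N \/ l.+1 = c].
  case: c {cm vc cv} => [|c]; first by exists 0%N; split=> //; left.
  by exists c; split=> //; right.
have [hi [hi1 hi2 him hib]] : exists h : nat, [/\ (c < h)%N, (h <= c.+2)%N,
    (h <= m)%N & h = m \/ h = c.+2].
  have [cm2|cm2] := leqP c.+2 m; first by exists c.+2; split => //; right.
  by exists m; split=> //; [exact: ltnW|left].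
exists (a + lo%:R * u, (hi%:R - lo%:R) * u) => /=.
have -> : a + lo%:R * u + (hi%:R - lo%:R) * u = a + hi%:R * u by ring.
have loc : lo%:R <= c%:R :> R by rewrite ler_nat.
have clo : c%:R <= lo%:R + 1 :> R by rewrite natr1 ler_nat.
have chi : c%:R + 1 <= hi%:R :> R by rewrite natr1 ler_nat.
have hic : hi%:R <= c%:R + 2 :> R by rewrite -natrD ler_nat addn2.
have hiM : hi%:R <= m%:R :> R by rewrite ler_nat.
have lo00 : 0 <= lo%:R :> R by [].
split.
- by rewrite wE; split; nra.
- by apply/andP; split; nra.
- by apply/andP; split; nra.
- case: lob => [->|loE]; [by left; rewrite mul0r addr0|right].
  split; first by exists lo; [exact: leq_trans (ltnW cm)|rewrite nE].
  have : c%:R = lo%:R + 1 :> R by rewrite natr1 loE.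
  by nra.
- case: hib => [->|hE]; [by left; rewrite [in RHS]wE|right].
  split; first by exists hi => //; rewrite nE.
  have : hi%:R = c%:R + 2 :> R by rewrite -natrD hE addn2.
  by nra.
Qed.

End OneDim.

Section Boxes.
Variables (R : realType) (d : nat).
Implicit Types (a w v x y : 'rV[R]_d) (phi : 'rV[R]_d -> R)
  (g : 'rV[R]_d -> 'rV[R]_d) (m M : nat) (j : 'I_d).

Definition sqnorm x : R := \sum_(i < d) x 0 i ^+ 2.

(** The only consequence of smoothness that the search uses.  It is one-sided,
    hence stable under adding convex quadratic penalties. *)
Definition descent (K : R) phi g : Prop := forall x y,
  unit_cube x -> unit_cube y ->
  phi y <= phi x + dot (g x) (y - x) + K * sqnorm (y - x).

Definition set_coord x j (z : R) : 'rV[R]_d :=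
  \row_i if i == j then z else x 0 i.

Lemma set_coordN x j z i : i != j -> set_coord x j z 0 i = x 0 i.
Proof. by rewrite mxE => /negbTE ->. Qed.

Lemma descent_coord K phi g x j (z : R) : descent K phi g -> unit_cube x ->
  0 <= z <= 1 ->
  phi (set_coord x j z) <=
    phi x + g x 0 j * (z - x 0 j) + K * (z - x 0 j) ^+ 2.
Proof.
move=> dphi xC z01; have /(dphi _ _ xC) : unit_cube (set_coord x j z).
  by move=> i; rewrite mxE; case: eqP.
have single (F : 'I_d -> R) : (forall i, i != j -> F i = 0) -> \sum_i F i = F j.
  by move=> F0; rewrite (bigD1 j) //= big1 ?addr0.
rewrite /dot /sqnorm !single; rewrite ?mxE ?eqxx // => i ij.
  by rewrite !mxE (negbTE ij) subrr expr0n.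
by rewrite !mxE (negbTE ij) subrr mulr0.
Qed.

Definition in_box a w x : Prop := forall j, a 0 j <= x 0 j <= a 0 j + w 0 j.

(** The boundary of the box relative to the unit cube: faces of the box that are
    contained in faces of the cube are left out, since a minimizer may lie there
    and still be stationary for the constrained problem. *)
Definition on_rel_boundary a w x : Prop := exists j,
  (x 0 j = a 0 j /\ a 0 j != 0) \/
  (x 0 j = a 0 j + w 0 j /\ a 0 j + w 0 j != 1).

Definition sub_cube a w : Prop := forall j, 0 <= a 0 j /\ a 0 j + w 0 j <= 1.

Lemma in_box_cube a w x : sub_cube a w -> in_box a w x -> unit_cube x.
Proof.
move=> awC xB j; have [a0 aw1] := awC j; have /andP[ax xaw] := xB j.
by rewrite (le_trans a0 ax) (le_trans xaw aw1).
Qed.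

(** Each coordinate lies between two grid values; moving to the one in whose
    direction the partial derivative is nonpositive leaves only the quadratic
    term of [descent].  The coordinates outside s are kept, so that a point of a
    hyperplane rounds to a net point of the same hyperplane. *)
Lemma round_to_grid K phi g a w M (h : R) (s : seq 'I_d) x :
  descent K phi g -> 0 <= K -> sub_cube a w -> (0 < M)%N ->
  (forall j, 0 <= w 0 j) -> (forall j, w 0 j / M%:R <= h) -> in_box a w x ->
  exists p, [/\ in_box a w p,
    (forall j, j \in s -> on_grid M (a 0 j) (w 0 j) (p 0 j)),
    (forall j, j \notin s -> p 0 j = x 0 j) &
    phi p <= phi x + (size s)%:R * (K * h ^+ 2)].
Proof.
move=> dphi K0 awC M0 w0 wh xB; have MR : 0 < M%:R :> R by rewrite ltr0n.
elim: s => [|j s [p [pB pmark pN phip]]].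
  by exists x; split => //; rewrite mul0r addr0.
have [n nM /andP[lop phi']] := on_grid_bracket M0 (pB j).
have [z [zmark zg zh]] : exists z, [/\ on_grid M (a 0 j) (w 0 j) z,
    g p 0 j * (z - p 0 j) <= 0 & (z - p 0 j) ^+ 2 <= h ^+ 2].
  have stepE : n.+1%:R / M%:R * w 0 j = n%:R / M%:R * w 0 j + w 0 j / M%:R.
    by rewrite -natr1; field; rewrite gt_eqF.
  have := wh j; move: lop phi'; rewrite stepE.
  set lo := _ / _ * _; set u := w 0 j / _ => lop phi' uh.
  have [g0|g0] := leP 0 (g p 0 j).
    exists (a 0 j + lo); split; first by exists n => //; exact: ltnW.
      by nra.
    by nra.
  exists (a 0 j + n.+1%:R / M%:R * w 0 j); split; first by exists n.+1.
    by rewrite stepE -/lo -/u; nra.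
  by rewrite stepE -/lo -/u; nra.
have zB := on_grid_in (w0 j) zmark.
exists (set_coord p j z); split.
- by move=> i; rewrite mxE; case: eqP => [->|_].
- move=> i; rewrite inE mxE; case: eqP => [-> //|/eqP ij] /=.
  exact: pmark.
- by move=> i; rewrite inE negb_or => /andP[ij /pN]; rewrite set_coordN.
- have z01 : 0 <= z <= 1.
    have [a0 aw1] := awC j; have /andP[az zaw] := zB.
    by rewrite (le_trans a0 az) (le_trans zaw aw1).
  have := descent_coord j dphi (in_box_cube awC pB) z01.
  by rewrite /= -natr1; nra.
Qed.

(** The index chooses a direction j, one of the m + 1 hyperplanes orthogonal to
    it, and a point of the grid of mesh 1/M on that hyperplane; [unlift]
    enumerates the d - 1 other coordinates. *)
Definition net_point m M a w
    (t : 'I_d * 'I_m.+1 * {ffun 'I_d.-1 -> 'I_M.+1}) : 'rV[R]_d :=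
  \row_j (a 0 j + match unlift t.1.1 j with
                  | None => t.1.2%:R / m%:R
                  | Some i => (t.2 i)%:R / M%:R
                  end * w 0 j).

Definition net m M a w : seq 'rV[R]_d :=
  [seq net_point a w t | t : 'I_d * 'I_m.+1 * {ffun 'I_d.-1 -> 'I_M.+1}].

Lemma size_net m M a w : size (net m M a w) = (d * m.+1 * M.+1 ^ d.-1)%N.
Proof. by rewrite size_map -cardE !card_prod card_ffun !card_ord. Qed.

Lemma netP m M a w x : x \in net m M a w <->
  exists j, on_grid m (a 0 j) (w 0 j) (x 0 j) /\
    forall i, i != j -> on_grid M (a 0 i) (w 0 i) (x 0 i).
Proof.
split=> [/mapP[[[j t] f] _ ->]|[j [[t tm xj] xN]]].
  exists j; split.
    by exists t; [rewrite -ltnS|rewrite mxE unlift_none].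
  move=> i ij; have [l iE _] := unlift_some (contra_neq esym ij).
  by exists (f l); [rewrite -ltnS|rewrite mxE iE liftK].
have /choice[n nP] : forall l : 'I_d.-1, exists n : nat, (n <= M)%N /\
    x 0 (lift j l) = a 0 (lift j l) + n%:R / M%:R * w 0 (lift j l).
  by move=> l; have [|n nM nE] := xN (lift j l); [rewrite eq_sym neq_lift|exists n].
apply/mapP; exists (j, inord t, [ffun l => inord (n l)]) => /=.
  by rewrite mem_enum.
apply/rowP => i; rewrite mxE /=; case: unliftP => [l ->|->].
  by rewrite ffunE inordK ?ltnS; have [] := nP l.
by rewrite inordK.
Qed.

(** A point of the relative boundary of the zoomed box was there before or lies on
    a cutting hyperplane, at least one cell away from v. *)
Lemma zoom m a w v : (0 < m)%N -> (forall j, 0 < w 0 j) -> in_box a w v ->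
  exists p : 'rV[R]_d * 'rV[R]_d, [/\
    (forall x, in_box p.1 p.2 x -> in_box a w x),
    (sub_cube a w -> sub_cube p.1 p.2),
    (forall j, w 0 j / m%:R <= p.2 0 j <= 3 * (w 0 j / m%:R)),
    in_box p.1 p.2 v &
    forall x, on_rel_boundary p.1 p.2 x -> on_rel_boundary a w x \/
      exists j, on_grid m (a 0 j) (w 0 j) (x 0 j) /\
        (w 0 j / m%:R) ^+ 2 <= (x 0 j - v 0 j) ^+ 2].
Proof.
move=> m0 w0 vB; have /choice[p pP] := fun j => zoom1 m0 (w0 j) (vB j).
exists (\row_j (p j).1, \row_j (p j).2) => /=; split.
- move=> x xB j; have := xB j; rewrite !mxE.
  by have [[lo hi] _ _ _ _] := pP j => /andP[lx xh]; rewrite (le_trans lo lx) (le_trans xh hi).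
- move=> awC j; rewrite !mxE; have [a0 aw1] := awC j.
  by have [[lo hi] _ _ _ _] := pP j; split; [exact: le_trans lo|exact: le_trans hi _].
- by move=> j; rewrite !mxE; have [] := pP j.
- by move=> j; rewrite !mxE; have [] := pP j.
move=> x [j]; rewrite !mxE.
have wm0 : 0 < w 0 j / m%:R by rewrite divr_gt0 // ltr0n.
have [_ _ _ plo phi] := pP j => -[[xE n0]|[xE n1]].
  case: plo => [pE|[pm pd]]; first by left; exists j; left; rewrite -pE.
  by right; exists j; rewrite xE; split => //; nra.
case: phi => [pE|[pm pd]]; first by left; exists j; right; rewrite -pE.
by right; exists j; rewrite xE; split => //; nra.
Qed.

End Boxes.

(** * One round of the search *)

Section Rounds.
Variables (R : realType) (d : nat).
Implicit Types (a w v x y : 'rV[R]_d) (phi : 'rV[R]_d -> R)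
  (g : 'rV[R]_d -> 'rV[R]_d) (m M : nat) (j : 'I_d) (A : algorithm R d).

Lemma sqnorm_ge0 x : 0 <= sqnorm x.
Proof. by apply: sumr_ge0 => i _; exact: sqr_ge0. Qed.

Lemma sqnorm_ge_coord x j : x 0 j ^+ 2 <= sqnorm x.
Proof.
by rewrite /sqnorm (bigD1 j) //= lerDl; apply: sumr_ge0 => i _; exact: sqr_ge0.
Qed.

Lemma descent_add_sqnorm K mu phi g v : descent K phi g ->
  descent (K + mu) (fun x => phi x + mu * sqnorm (x - v))
    (fun x => g x + (2 * mu) *: (x - v)).
Proof.
move=> dphi x y xC yC; have := dphi x y xC yC.
suff -> : mu * sqnorm (y - v) = mu * sqnorm (x - v) +
    (dot (g x + (2 * mu) *: (x - v)) (y - x) - dot (g x) (y - x)) +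
    mu * sqnorm (y - x) by lra.
rewrite /dot /sqnorm !mulr_sumr -sumrB -!big_split /=; apply: eq_bigr => i _.
by rewrite !mxE; ring.
Qed.

Lemma proj_grad_near (tau beta : R) x (u u' : 'rV[R]_d) j :
  `|proj_grad x u 0 j| <= tau -> `|u' 0 j - u 0 j| <= beta ->
  `|proj_grad x u' 0 j| <= tau + beta.
Proof.
rewrite !mxE; set s := u 0 j; set s' := u' 0 j.
case: ifP => _; [|case: ifP => _].
- by rewrite !minEle !ler_norml; case: (leP 0 s); case: (leP 0 s'); lra.
- by rewrite !maxEle !ler_norml; case: (leP 0 s); case: (leP 0 s'); lra.
- by rewrite !ler_norml; lra.
Qed.

Definition finds A (r : nat) (N tau slack : R) a w v phi g : Prop :=
  [/\ forall i, (i < r)%N -> (forall x, x \in batch A phi i -> unit_cube x) /\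
        (size (batch A phi i))%:R <= N,
      in_box a w (output A phi r),
      forall j, `|proj_grad (output A phi r) (g (output A phi r)) 0 j| <= tau &
      phi (output A phi r) <= phi v + slack].

(** Success of some r-round algorithm on all objectives for which the boundary of
    the box carries the certificate.  The bound on the final value lets a
    later argument exclude the boundary of the cube. *)
Definition solvable (r : nat) (N tau K slack : R) a w v : Prop :=
  exists A, forall phi g, descent K phi g ->
    (forall x, in_box a w x -> on_rel_boundary a w x ->
       phi v + slack <= phi x) ->
    finds A r N tau slack a w v phi g.

Lemma nth_index_map_seq phi (q : seq 'rV[R]_d) x : x \in q ->
  nth 0 (map phi q) (index x q) = phi x.
Proof. by move=> xq; rewrite (nth_map 0) ?index_mem // nth_index. Qed.

Lemma net_in_box m M a w x : (forall j, 0 <= w 0 j) ->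
  x \in net m M a w -> in_box a w x.
Proof.
move=> w0 /netP[j [xj xN]] i; have [->|ij] := eqVneq i j.
  exact: on_grid_in (w0 j) xj.
exact: on_grid_in (w0 i) (xN i ij).
Qed.

(** A grid neighbour of y in direction j shows that the partial derivative cannot
    point downhill by more than K times the mesh.  A neighbour is missing only on
    a face of the cube, where [proj_grad] ignores the corresponding sign. *)
Lemma grid_argmin_kkt K phi g a w M (h tau : R) y : descent K phi g ->
  sub_cube a w -> (0 < M)%N -> (forall j, 0 < w 0 j) -> 0 <= K ->
  (forall j, w 0 j / M%:R <= h) -> K * h <= tau ->
  (forall j, on_grid M (a 0 j) (w 0 j) (y 0 j)) ->
  (forall x, (forall j, on_grid M (a 0 j) (w 0 j) (x 0 j)) -> phi y <= phi x) ->
  ~ on_rel_boundary a w y ->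
  forall j, `|proj_grad y (g y) 0 j| <= tau.
Proof.
move=> dphi awC M0 w0 K0 wh Kh ymark ymin yint j.
have ge0w i : 0 <= w 0 i by exact: ltW.
have yB : in_box a w y by move=> i; exact: on_grid_in (ge0w i) (ymark i).
have yC := in_box_cube awC yB; have [a0 aw1] := awC j.
have MR : 0 < M%:R :> R by rewrite ltr0n.
have u0 : 0 < w 0 j / M%:R by rewrite divr_gt0.
have move_mark z : on_grid M (a 0 j) (w 0 j) z ->
    0 <= g y 0 j * (z - y 0 j) + K * (z - y 0 j) ^+ 2.
  move=> zmark; have := on_grid_in (ge0w j) zmark => /andP[az zaw].
  have z01 : 0 <= z <= 1 by rewrite (le_trans a0 az) (le_trans zaw aw1).
  have := descent_coord j dphi yC z01.
  have : phi y <= phi (set_coord y j z).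
    by apply: ymin => i; rewrite mxE; case: eqP => [->|_].
  by lra.
have up : y 0 j != a 0 j + w 0 j -> - tau <= g y 0 j.
  move=> ne; have := move_mark _ (on_grid_next M0 (ymark j) ne).
  have := wh j; set u := w 0 j / _ in u0 *.
  have -> : y 0 j + u - y 0 j = u by ring.
  by move=> /(ler_wpM2l K0) Ku; nra.
have down : y 0 j != a 0 j -> g y 0 j <= tau.
  move=> ne; have := move_mark _ (on_grid_prev M0 (ymark j) ne).
  have := wh j; set u := w 0 j / _ in u0 *.
  have -> : y 0 j - u - y 0 j = - u by ring.
  by move=> /(ler_wpM2l K0) Ku; nra.
have tau0 : 0 <= tau by apply: le_trans Kh; have := wh j; nra.
have /andP[ay yaw] := yB j; have wj0 := w0 j.
rewrite mxE; case: eqP => [y0|/eqP yn0].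
  have /up g0 : y 0 j != a 0 j + w 0 j.
    by rewrite y0 lt_eqF //; move: a0; rewrite le_eqVlt; lra.
  by rewrite minEle; case: (leP 0 (g y 0 j)) => g1; rewrite ler_norml; lra.
case: eqP => [y1|/eqP yn1].
  have /down g0 : y 0 j != a 0 j by rewrite gt_eqF //; lra.
  by rewrite maxEle; case: (leP 0 (g y 0 j)) => g1; rewrite ler_norml; lra.
rewrite ler_norml up ?down //; apply/eqP => yE; apply: yint; exists j.
  by left; split=> //; rewrite -yE.
by right; split=> //; rewrite -yE.
Qed.

(** The slack exceeds the rounding error, so that the grid minimum is strictly
    below the values on the relative boundary. *)
Lemma last_round (N tau K slack h : R) a w v M : (0 < d)%N ->
  sub_cube a w -> (forall j, 0 < w 0 j) -> in_box a w v ->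
  (0 < M)%N -> 0 <= K -> (forall j, w 0 j / M%:R <= h) ->
  d%:R * (K * h ^+ 2) < slack -> K * h <= tau ->
  (size (net M M a w))%:R <= N ->
  solvable 1 N tau K slack a w v.
Proof.
move=> d0 awC w0 vB M0 K0 wh hslack htau hN.
have ge0w i : 0 <= w 0 i by exact: ltW.
have gridP x : x \in net M M a w <->
    forall j, on_grid M (a 0 j) (w 0 j) (x 0 j).
  rewrite netP; split=> [[j [xj xN]] i|xM].
    by have [->|/xN] := eqVneq i j.
  by exists (Ordinal d0).
have anet : a \in net M M a w.
  by rewrite gridP => j; exists 0%N; rewrite // mul0r mul0r addr0.
set q := net M M a w in hN gridP anet *.
have /choice[best bestP] : forall ans : seq R, exists y, y \in q /\
    forall x, x \in q -> nth 0 ans (index y q) <= nth 0 ans (index x q).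
  by move=> ans; have [y yq ymin] := argmin_seq (fun x => nth 0 ans (index x q)) anet;
    exists y.
exists (then_alg q (fun ans => Algorithm (fun=> [::]) (fun=> best ans))).
move=> phi g dphi bnd; rewrite /finds output_thenS /output /=.
set y := best _; have [yq ymin] := bestP (map phi q).
have {}ymin x : x \in q -> phi y <= phi x.
  by move=> xq; have := ymin _ xq; rewrite !nth_index_map_seq.
have [p [pB pM _ phip]] :=
  round_to_grid (enum 'I_d) dphi K0 awC M0 ge0w wh vB.
have yp : phi y <= phi p by apply: ymin; rewrite gridP => j; apply: pM; rewrite mem_enum.
rewrite size_enum_ord in phip.
have yv : phi y < phi v + slack by lra.
have yB : in_box a w y by exact: net_in_box yq.
split => //; last exact: ltW.
- by case=> // _; split=> // x /(net_in_box ge0w); apply: in_box_cube.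
- apply: (grid_argmin_kkt dphi awC M0 w0 K0 wh htau).
  + exact/gridP.
  + by move=> x xM; apply: ymin; rewrite gridP.
  + by move=> /(bnd _ yB); rewrite leNgt yv.
Qed.

(** One query round followed by an algorithm for the penalized objective on the
    zoomed box.  Old boundary points keep their certificate because the penalty is
    nonnegative and the value at the centre did not increase; new ones get it
    from the penalty, which pays for the slack and for the rounding error. *)
Lemma zoom_round (r : nat) (N tau beta mu K slack h s : R) a w v m M :
  sub_cube a w -> (forall j, 0 < w 0 j) -> in_box a w v ->
  (0 < m)%N -> (0 < M)%N -> 0 <= K -> 0 <= mu -> 0 <= s -> 0 <= slack ->
  (forall j, w 0 j / M%:R <= h) -> (forall j, s <= w 0 j / m%:R) ->
  (forall j, 2 * mu * (3 * (w 0 j / m%:R)) <= beta) ->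
  slack + d%:R * (K * h ^+ 2) <= mu * s ^+ 2 ->
  (size (net m M a w)).+1%:R <= N ->
  (forall a' w' v', sub_cube a' w' -> in_box a' w' v' ->
     (forall j, w 0 j / m%:R <= w' 0 j <= 3 * (w 0 j / m%:R)) ->
     solvable r N tau (K + mu) slack a' w' v') ->
  solvable r.+1 N (tau + beta) K slack a w v.
Proof.
move=> awC w0 vB m0 M0 K0 mu0 s0 slack0 wh ws wbeta gap hN IH.
have ge0w i : 0 <= w 0 i by exact: ltW.
set q := v :: net m M a w.
have qB x : x \in q -> in_box a w x.
  by rewrite inE => /orP[/eqP -> //|/(net_in_box ge0w)].
have /choice[c cP] : forall ans : seq R,
    exists t : 'rV[R]_d * ('rV[R]_d * 'rV[R]_d) * algorithm R d,
    let v' := t.1.1 in let p := t.1.2 in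
    [/\ v' \in q, forall x, x \in q -> nth 0 ans (index v' q) <= nth 0 ans (index x q),
      (forall x, in_box p.1 p.2 x -> in_box a w x),
      (forall j, 0 <= p.2 0 j <= 3 * (w 0 j / m%:R)) /\ in_box p.1 p.2 v' &
      (forall x, on_rel_boundary p.1 p.2 x -> on_rel_boundary a w x \/
        exists j, on_grid m (a 0 j) (w 0 j) (x 0 j) /\
          (w 0 j / m%:R) ^+ 2 <= (x 0 j - v' 0 j) ^+ 2) /\
      forall phi g, descent (K + mu) phi g ->
        (forall x, in_box p.1 p.2 x -> on_rel_boundary p.1 p.2 x ->
          phi v' + slack <= phi x) ->
        finds t.2 r N tau slack p.1 p.2 v' phi g].
  move=> ans; have [v' v'q v'min] :=
    argmin_seq (fun x => nth 0 ans (index x q)) (mem_head v (net m M a w)).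
  have [p [pB pC pw v'p pbd]] := zoom m0 w0 (qB _ v'q).
  have [A AP] := IH p.1 p.2 v' (pC awC) v'p pw.
  exists (v', p, A); split => //=; split => // j.
  have /andP[wp ->] := pw j; rewrite andbT (le_trans _ wp) //.
  by rewrite divr_ge0.
pose pen v' x : R := mu * sqnorm (x - v').
exists (then_alg q (fun ans =>
  simulate (c ans).2 id (fun x z => z + pen (c ans).1.1 x))).
move=> phi g dphi bnd; set ans := map phi q.
have [v'q v'min pB [pw v'p] [pbd AP]] := cP ans.
set v' := (c ans).1.1 in v'q v'min v'p pbd AP *.
set p := (c ans).1.2 in pB pw v'p pbd AP *.
set A := (c ans).2 in AP *.
have {}v'min x : x \in q -> phi v' <= phi x.
  by move=> xq; have := v'min _ xq; rewrite !nth_index_map_seq.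
pose phi' x := phi x + pen v' x.
have phi'E x : phi' x = phi x + pen v' (id x) by [].
have penv' : phi' v' = phi v'.
  rewrite /phi' /pen subrr /sqnorm big1 ?mulr0 ?addr0 // => i _.
  by rewrite mxE expr0n.
have phiphi' x : phi x <= phi' x by rewrite lerDl mulr_ge0 ?sqnorm_ge0.
have v'v : phi v' <= phi v by exact/v'min/mem_head.
have bnd' x : in_box p.1 p.2 x -> on_rel_boundary p.1 p.2 x ->
    phi' v' + slack <= phi' x.
  move=> xp /pbd[xbd|[j [xj xfar]]].
    rewrite penv'; have := bnd x (pB _ xp) xbd; have := phiphi' x; lra.
  have [y [yB yM yN phiy]] :=
    round_to_grid (enum (predC1 j)) dphi K0 awC M0 ge0w wh (pB _ xp).
  have yq : y \in q.
    rewrite inE; apply/orP; right; apply/netP; exists j; split.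
      by rewrite yN // mem_enum inE eqxx.
    by move=> i ij; apply: yM; rewrite mem_enum inE.
  have := v'min _ yq; rewrite penv' /phi' /pen.
  have := sqnorm_ge_coord (x - v') j; rewrite !mxE.
  have : (size (enum (predC1 j)))%:R * (K * h ^+ 2) <= d%:R * (K * h ^+ 2).
    apply: ler_wpM2r; first by rewrite mulr_ge0 ?sqr_ge0.
    by rewrite ler_nat -cardE (leq_trans (max_card _)) ?card_ord.
  have := ws j; move: gap xfar phiy; set u := w 0 j / _; set e := _ * (K * _).
  set e' := _ * (K * _); set t := sqnorm _; set z := (_ - _) ^+ 2.
  move=> gap uz phiy su e'e zt.
  have : s ^+ 2 <= t.
    apply: le_trans zt; apply: le_trans uz.
    by rewrite ler_pXn2r // nnegrE //; lra.
  by move=> /(ler_wpM2l mu0); lra.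
have [Ab Aout Akkt Aval] := AP _ _ (descent_add_sqnorm mu v' dphi) bnd'.
rewrite /finds output_thenS -/ans (output_simulate A r phi'E).
set y := output A phi' r in Aout Akkt Aval *; change (id y) with y.
split.
- case=> [|i] ir.
    by split=> // x xq; exact: in_box_cube awC (qB _ xq).
  by rewrite batch_thenS -/ans (batch_simulate A i phi'E) map_id; apply: Ab.
- exact: pB.
- move=> j; apply: proj_grad_near (Akkt j) _; rewrite !mxE.
  have := wbeta j; have := Aout j; have := v'p j; have := pw j.
  set b := p.2 0 j; set l := p.1 0 j; set u := w 0 j / _.
  move=> /andP[b0 bu] /andP[lv' v'b] /andP[ly yb] ub.
  have -> : g y 0 j - (g y 0 j + 2 * mu * (y 0 j - v' 0 j)) =
    2 * mu * (v' 0 j - y 0 j) by ring.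
  rewrite ler_norml; apply/andP; split; nra.
- have : phi' y <= phi' v' + slack by exact: Aval.
  by rewrite penv'; have := phiphi' y; lra.
Qed.

End Rounds.

(** * The schedule of the rounds *)

Lemma solvableS (R : realType) (d r : nat) (N tau K K' slack : R)
    (a w v : 'rV[R]_d) :
  K <= K' -> solvable r N tau K' slack a w v -> solvable r N tau K slack a w v.
Proof.
move=> KK' [A AP]; exists A => phi g dphi; apply: AP => x y xC yC.
apply: le_trans (dphi x y xC yC) _; rewrite lerD2l.
by apply: ler_wpM2r; rewrite ?sqnorm_ge0.
Qed.

Lemma nat_near (R : realType) (t : R) : 1 <= t ->
  exists2 n : nat, (0 < n)%N & t <= n%:R <= 2 * t.
Proof.
move=> t1; have t0 : 0 <= t by lra.
exists (Num.truncn t).+1 => //.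
have /andP[t2 t3] := truncn_itv t0.
by rewrite (ltW t3) /= -natr1; lra.
Qed.

(** D i is the scale of the box before round i, up to factors 2^i and 3^i that
    come from rounding to integers and from keeping three cells per direction;
    rho i and tau i are the real counterparts of the numbers of cells and of net
    points per direction, and X is the common cost of the rounds. *)
Section Schedule.
Variables (R : realType) (d k : nat) (delta X : R) (D rho tau : nat -> R).
Hypotheses (d_gt0 : (0 < d)%N) (k_gt0 : (0 < k)%N).
Hypotheses (delta_gt0 : 0 < delta) (Dk : D k = delta).
Hypothesis D_ge : forall i, (i <= k)%N -> delta <= D i.
Hypotheses (rho_ge1 : forall i, (i < k)%N -> 1 <= rho i)
  (tau_ge1 : forall i, (i < k)%N -> 1 <= tau i)
  (rhoE : forall i, D i.+1 * rho i = D i)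
  (tauE : forall i, tau i ^+ 2 * (delta * D i.+1) = D i ^+ 2)
  (XE : forall i, rho i * tau i ^+ d.-1 = X).

(** Small enough that the penalties of all the rounds together add at most
    delta / 2 to each partial derivative and 1 to the constant of [descent]. *)
Definition penalty_const : R := (4 * k%:R * d%:R * 3 ^+ k)^-1.
(** Large enough that the rounding error is at most half of what the penalty adds
    on the new boundary. *)
Definition net_const : R := 1 + 4 * d%:R * 9 ^+ k * 2 ^+ k / penalty_const.
Definition slack_at : R := penalty_const * delta ^+ 2 / (2 * 2 ^+ k).
Definition batch_const : R := d.+1%:R * (3 * net_const) ^+ d.

Local Notation c := penalty_const.
Local Notation K := net_const.

Let k0 : 0 < k%:R :> R. Proof. by rewrite ltr0n. Qed.
Let d1 : 1 <= d%:R :> R. Proof. by rewrite ler1n. Qed.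
Let P1 : 1 <= 2 ^+ k :> R. Proof. by rewrite exprn_ege1 // ler1n. Qed.
Let Q1 : 1 <= 3 ^+ k :> R. Proof. by rewrite exprn_ege1 // ler1n. Qed.
Let PQ : 2 ^+ k <= 3 ^+ k :> R.
Proof. by apply: lerXn2r; rewrite ?nnegrE ?ler_nat. Qed.
Let Q2 : 9 ^+ k = 3 ^+ k ^+ 2 :> R.
Proof. by rewrite exprAC; congr (_ ^+ _); ring. Qed.

Let cden_gt0 : 0 < 4 * k%:R * d%:R * 3 ^+ k :> R.
Proof. by rewrite !mulr_gt0 ?exprn_gt0 ?ltr0n. Qed.

Let cE : c * (4 * k%:R * d%:R * 3 ^+ k) = 1.
Proof. by rewrite mulVf // gt_eqF. Qed.

Let c0 : 0 < c. Proof. by rewrite invr_gt0. Qed.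

Let KcE : K * c = c + 4 * d%:R * (3 ^+ k) ^+ 2 * 2 ^+ k.
Proof. by rewrite /K Q2 mulrDl mul1r divfK // gt_eqF. Qed.

Let c1 : c <= 1.
Proof.
have k1 : 1 <= k%:R :> R by rewrite ler1n.
rewrite invf_le1 //; have : 1 <= k%:R * d%:R :> R by have := d1; nra.
have hQ := Q1; set z := k%:R * d%:R => z1.
have -> : 4 * k%:R * d%:R * 3 ^+ k = 4 * (z * 3 ^+ k) by rewrite /z; ring.
by nra.
Qed.

Let K_ge : 4 * 3 ^+ k <= K.
Proof.
rewrite -(ler_pM2r c0) KcE; have hd := d1; have hc := c0; have hc1 := c1.
have := P1; have := Q1; set q := 3 ^+ k; set p := 2 ^+ k => hQ hP.
have dqp : q <= d%:R * q ^+ 2 * p.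
  have : q <= q ^+ 2 by nra.
  by move=> qq; have : q ^+ 2 <= d%:R * q ^+ 2; nra.
have : q * c <= q by nra.
by nra.
Qed.

Let K1 : 1 <= K. Proof. by have := K_ge; have := Q1; lra. Qed.

Lemma batch_size i m M a w : (i < k)%N ->
  m%:R <= 2 * (K * rho i) -> M%:R <= 2 * (K * tau i) ->
  (size (@net R d m M a w)).+1%:R <= batch_const * X.
Proof.
move=> ik hm hM; have hK1 := K1; have r1 := rho_ge1 ik; have t1 := tau_ge1 ik.
have K0 : 0 <= K by lra.
have Kr : 1 <= K * rho i by nra.
have Kt : 1 <= K * tau i by nra.
have X1 : 1 <= X.
  by rewrite -(XE i) -[1]mulr1 ler_pM // exprn_ege1.
have prod_le : (m.+1 * M.+1 ^ d.-1)%:R <= (3 * K) ^+ d * X.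
  rewrite -(XE i) -[in X in _ ^+ X](prednK d_gt0) exprS natrM natrX.
  have -> : 3 * K * (3 * K) ^+ d.-1 * (rho i * tau i ^+ d.-1) =
    (3 * K * rho i) * (3 * K * tau i) ^+ d.-1 by rewrite !exprMn; ring.
  apply: ler_pM => //; first by rewrite -natr1; lra.
  apply: lerXn2r; rewrite ?nnegrE //; first by rewrite !mulr_ge0 //; lra.
  by rewrite -natr1; lra.
have KX : 1 <= (3 * K) ^+ d * X.
  by rewrite -[1]mulr1 ler_pM // exprn_ege1 //; lra.
rewrite size_net -mulnA -[X in X%:R]addn1 natrD natrM /batch_const -mulrA -natr1.
by have : 0 <= d%:R :> R by []; nra.
Qed.

(** The square of the mesh is O(delta D_{i+1}). *)
Lemma spacing_sq_le i (s : R) M : (i < k)%N -> 0 < s <= D i ->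
  K * tau i <= M%:R ->
  (3 ^+ k * s / M%:R) ^+ 2 * K ^+ 2 <= (3 ^+ k) ^+ 2 * (delta * D i.+1).
Proof.
move=> ik /andP[s0 sD] KM; have t0 : 0 < tau i := lt_le_trans ltr01 (tau_ge1 ik).
have K0 : 0 < K := lt_le_trans ltr01 K1.
have M0 : 0 < M%:R :> R by apply: lt_le_trans KM; rewrite mulr_gt0.
have Q0 : 0 < 3 ^+ k :> R by rewrite exprn_gt0.
have D0 : 0 < D i := lt_le_trans s0 sD.
rewrite -(ler_pM2r (exprn_gt0 2 t0)).
have -> : (3 ^+ k) ^+ 2 * (delta * D i.+1) * tau i ^+ 2 = (3 ^+ k * D i) ^+ 2.
  by rewrite exprMn -tauE; ring.
rewrite -!exprMn; apply: lerXn2r; rewrite ?nnegrE.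
- by rewrite !mulr_ge0 ?invr_ge0 // ltW.
- by rewrite mulr_ge0 // ltW.
have -> : 3 ^+ k * s / M%:R * K * tau i = 3 ^+ k * (s * (K * tau i / M%:R)).
  by ring.
have KtM : K * tau i / M%:R <= 1 by rewrite ler_pdivrMr // mul1r.
rewrite ler_pM2l // -[leRHS]mulr1; apply: ler_pM => //; first exact: ltW.
by rewrite !mulr_ge0 ?invr_ge0 // ltW.
Qed.

Lemma rounding_error_lt (e h t : R) : 0 <= e <= 1 -> 0 < t ->
  h ^+ 2 * K ^+ 2 <= (3 ^+ k) ^+ 2 * (delta * t) ->
  d%:R * ((1 + e) * h ^+ 2) < c * delta * t / (2 * 2 ^+ k).
Proof.
move=> /andP[e0 e1] t0 hhK.
have dt : 0 < delta * t by rewrite mulr_gt0.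
have hd := d1; have hP := P1; have hc := c0.
have K0 : 0 < K := lt_le_trans ltr01 K1.
have hK := ler_peMl (ltW dt) K1.
have hKc := KcE.
set q := 3 ^+ k in hhK hKc *; set p := 2 ^+ k in hP hKc *.
have dp0 : 0 < d%:R * p by rewrite mulr_gt0 //; apply: lt_le_trans ltr01 _.
have p2 : 0 < 2 * p by rewrite mulr_gt0 //; apply: lt_le_trans ltr01 _.
have h20 : 0 <= d%:R * p * h ^+ 2 by rewrite mulr_ge0 ?sqr_ge0 // ltW.
rewrite ltr_pdivlMr //.
apply: (@le_lt_trans _ _ (4 * (d%:R * p * h ^+ 2))).
  have -> : d%:R * ((1 + e) * h ^+ 2) * (2 * p) =
    (2 + 2 * e) * (d%:R * p * h ^+ 2) by ring.
  by rewrite ler_wpM2r //; lra.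
rewrite -(ltr_pM2r (exprn_gt0 2 K0)).
have -> : c * delta * t * K ^+ 2 = (K * c) * (K * (delta * t)) by ring.
have -> : 4 * (d%:R * p * h ^+ 2) * K ^+ 2 = 4 * (d%:R * p) * (h ^+ 2 * K ^+ 2).
  by ring.
apply: (@le_lt_trans _ _ (4 * (d%:R * p) * (q ^+ 2 * (delta * t)))).
  by rewrite ler_pM2l // mulr_gt0.
have -> : 4 * (d%:R * p) * (q ^+ 2 * (delta * t)) =
  (4 * d%:R * q ^+ 2 * p) * (delta * t) by ring.
have Kdt : 0 < K * (delta * t) by rewrite mulr_gt0.
apply: (@le_lt_trans _ _ (4 * d%:R * q ^+ 2 * p * (K * (delta * t)))).
  by rewrite ler_wpM2l // !mulr_ge0 ?sqr_ge0 ?ler0n //; apply: le_trans ler01 _.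
by rewrite ltr_pM2r // hKc ltrDr.
Qed.

Lemma Kmul_ge1 (t : R) : 1 <= t -> 1 <= K * t.
Proof. by move=> t1; rewrite -[1]mulr1 ler_pM // K1. Qed.

(** As D k = delta, the relation between rho and tau makes them equal here: the
    hyperplane net of the last round is a full grid. *)
Lemma last_round_solvable i (a w v : 'rV[R]_d) (s : R) : i.+1 = k ->
  sub_cube a w -> in_box a w v -> 0 < s <= D i ->
  (forall j, s <= w 0 j <= 3 ^+ i * s) ->
  solvable 1 (batch_const * X) (delta * (1 - i%:R / (2 * k%:R)))
    (1 + i%:R / k%:R) slack_at a w v.
Proof.
move=> ik awC vB /andP[s0 sD] ws; have ltik : (i < k)%N by rewrite -ik.
have DS : D i.+1 = delta by rewrite -Dk -ik.
have taurho : tau i = rho i.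
  have d2 : delta ^+ 2 != 0 by rewrite expf_neq0 ?gt_eqF.
  have t2 : tau i ^+ 2 = rho i ^+ 2.
    apply: (mulIf d2); have := tauE i.
    by rewrite -(rhoE i) DS exprMn mulrC -expr2 mulrC [RHS]mulrC.
  have t0 : 0 <= tau i := le_trans ler01 (tau_ge1 ltik).
  have r0 : 0 <= rho i := le_trans ler01 (rho_ge1 ltik).
  by have := congr1 Num.sqrt t2; rewrite !sqrtr_sqr !ger0_norm.
have [M M0 /andP[KM MK]] := nat_near (Kmul_ge1 (tau_ge1 ltik)).
have MR : 0 < M%:R :> R by rewrite ltr0n.
have iQ : 3 ^+ i <= 3 ^+ k :> R by apply: ler_weXn2l; [rewrite ler1n|exact: ltnW].
have Q0 : 0 < 3 ^+ k :> R by rewrite exprn_gt0.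
pose h := 3 ^+ k * s / M%:R.
have wh j : w 0 j / M%:R <= h.
  have /andP[_ w3] := ws j; rewrite ler_pM2r ?invr_gt0 //.
  by apply: le_trans w3 _; rewrite ler_pM2r.
have h0 : 0 < h by rewrite !mulr_gt0 // invr_gt0.
have hhK : h ^+ 2 * K ^+ 2 <= (3 ^+ k) ^+ 2 * (delta * delta).
  by rewrite -{2}DS; apply: spacing_sq_le => //; rewrite s0.
set e : R := i%:R / k%:R.
have e0 : 0 <= e by rewrite divr_ge0.
have e1 : e < 1 by rewrite ltr_pdivrMr // mul1r ltr_nat.
apply: (last_round (M := M) (h := h)) => //.
- by move=> j; have /andP[sw _] := ws j; apply: lt_le_trans sw.
- by rewrite addr_ge0.
- have -> : slack_at = c * delta * delta / (2 * 2 ^+ k).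
    by rewrite /slack_at expr2 mulrA.
  by apply: rounding_error_lt; rewrite ?e0 ?(ltW e1).
- have -> : i%:R / (2 * k%:R) = e / 2 by rewrite /e; field; rewrite gt_eqF.
  have hK : h * K <= 3 ^+ k * delta.
    have K0 : 0 < K := lt_le_trans ltr01 K1.
    rewrite -(@ler_pXn2r _ 2) ?nnegrE ?(ltW (mulr_gt0 _ _)) //.
    by rewrite exprMn [leRHS]exprMn [delta ^+ 2]expr2.
  have h4 : h * 4 <= delta.
    rewrite -(ler_pM2l Q0); apply: le_trans hK.
    by rewrite mulrCA ler_pM2l // mulrC K_ge.
  by have := delta_gt0; nra.
- have := @batch_size i M M a w ltik; rewrite -taurho => /(_ MK MK).
  by apply: le_trans; rewrite ler_nat.
Qed.

(** The accuracy left to the later rounds decreases by delta / (2k) per round, the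
    effect of one penalty, and the constant of [descent] grows by 1/k. *)
Lemma schedule_solvable r i (a w v : 'rV[R]_d) (s : R) : (i + r.+1 = k)%N ->
  sub_cube a w -> in_box a w v -> D i / 2 ^+ i <= s <= D i ->
  (forall j, s <= w 0 j <= 3 ^+ i * s) ->
  solvable r.+1 (batch_const * X) (delta * (1 - i%:R / (2 * k%:R)))
    (1 + i%:R / k%:R) slack_at a w v.
Proof.
elim: r i a w v s => [|r IH] i a w v s ik awC vB /andP[sD Ds] ws.
all: have ltik : (i < k)%N by rewrite -ik addnS ltnS leq_addr.
all: have Di0 : 0 < D i by apply: lt_le_trans (D_ge (ltnW ltik)).
all: have s0 : 0 < s by apply: lt_le_trans sD; rewrite divr_gt0 ?exprn_gt0.
  by apply: last_round_solvable ws; rewrite ?s0 // -ik addn1.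
have ltSik : (i.+1 <= k)%N by [].
have r1 := rho_ge1 ltik; have r0 : 0 < rho i := lt_le_trans ltr01 r1.
have D'd := D_ge ltSik; have D'0 : 0 < D i.+1 by apply: lt_le_trans D'd.
have [m m0 /andP[rm mr]] := nat_near r1.
have [M M0 /andP[KM MK]] := nat_near (Kmul_ge1 (tau_ge1 ltik)).
have MR : 0 < M%:R :> R by rewrite ltr0n.
have mR : 0 < m%:R :> R by rewrite ltr0n.
pose s' := s / m%:R; have s'0 : 0 < s' by rewrite divr_gt0.
have s'E : s' * m%:R = s by rewrite /s' divfK ?gt_eqF.
have s'D : s' <= D i.+1.
  by rewrite /s' ler_pdivrMr //; apply: le_trans Ds _; rewrite -rhoE ler_pM2l.
have Ds' : D i.+1 / 2 ^+ i.+1 <= s'.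
  rewrite ler_pdivrMr ?exprn_gt0 // exprS -(ler_pM2r mR).
  have -> : s' * (2 * 2 ^+ i) * m%:R = 2 * (s * 2 ^+ i) by rewrite -s'E; ring.
  have : D i <= s * 2 ^+ i by rewrite -ler_pdivrMr ?exprn_gt0.
  rewrite -rhoE => Drs; apply: le_trans (_ : D i.+1 * (2 * rho i) <= _).
    by rewrite ler_pM2l.
  by rewrite mulrCA ler_pM2l.
have Dks' : D i.+1 <= s' * 2 ^+ k.
  rewrite ler_pdivrMr ?exprn_gt0 // in Ds'; apply: le_trans Ds' _.
  by rewrite ler_pM2l //; apply: ler_weXn2l => //; rewrite ler1n.
have iQ : 3 * 3 ^+ i <= 3 ^+ k :> R.
  by rewrite -exprS; apply: ler_weXn2l => //; rewrite ler1n.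
have w0 j : 0 < w 0 j by have /andP[sw _] := ws j; apply: lt_le_trans sw.
have wm j : s' <= w 0 j / m%:R <= 3 ^+ i * s'.
  have /andP[sw w3] := ws j; rewrite /s' mulrA.
  by rewrite !ler_pM2r ?invr_gt0 // sw w3.
pose h := 3 ^+ k * s / M%:R.
have wh j : w 0 j / M%:R <= h.
  have /andP[_ w3] := ws j; rewrite ler_pM2r ?invr_gt0 //.
  apply: le_trans w3 _; rewrite ler_pM2r //.
  by apply: le_trans iQ; rewrite ler_peMl ?exprn_ge0 // ler1n.
have hhK : h ^+ 2 * K ^+ 2 <= (3 ^+ k) ^+ 2 * (delta * D i.+1).
  by apply: spacing_sq_le => //; rewrite s0.
pose mu := c * delta / s'.
have mu0 : 0 < mu by rewrite !mulr_gt0 ?invr_gt0.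
have mus' : mu * s' = c * delta by rewrite /mu divfK ?gt_eqF.
have cpk : c * 2 ^+ k * k%:R <= 1.
  rewrite -[leRHS]cE; have kc : 0 < c * k%:R by rewrite mulr_gt0.
  have -> : c * 2 ^+ k * k%:R = (c * k%:R) * 2 ^+ k by ring.
  have -> : c * (4 * k%:R * d%:R * 3 ^+ k) = (c * k%:R) * (4 * d%:R * 3 ^+ k).
    by ring.
  rewrite ler_pM2l //; apply: le_trans PQ _; rewrite ler_peMl ?exprn_ge0 //.
  by have := d1; lra.
have muk : mu * k%:R <= 1.
  rewrite -(ler_pM2r s'0) mul1r mulrAC mus'.
  apply: (@le_trans _ _ (c * 2 ^+ k * k%:R * s')); last by rewrite ler_piMl // ltW.
  have -> : c * 2 ^+ k * k%:R * s' = (c * k%:R) * (s' * 2 ^+ k) by ring.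
  rewrite mulrAC ler_pM2l ?mulr_gt0 //; exact: le_trans Dks'.
set e : R := i%:R / k%:R.
have e0 : 0 <= e by rewrite divr_ge0.
have e1 : e <= 1 by rewrite ler_pdivrMr // mul1r ler_nat ltnW.
have -> : delta * (1 - i%:R / (2 * k%:R)) =
    delta * (1 - i.+1%:R / (2 * k%:R)) + delta / (2 * k%:R).
  by rewrite -natr1; field; rewrite gt_eqF.
apply: (zoom_round (m := m) (M := M) (mu := mu) (s := s') (h := h)) => //.
- by rewrite addr_ge0.
- exact: ltW.
- exact: ltW.
- by rewrite divr_ge0 ?mulr_ge0 ?sqr_ge0 ?exprn_ge0 // ltW.
- by move=> j; have /andP[] := wm j.
- move=> j; have /andP[_ wj] := wm j.
  rewrite ler_pdivlMr ?mulr_gt0 //.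
  apply: (@le_trans _ _ (2 * mu * (3 * (3 ^+ i * s')) * (2 * k%:R))).
    rewrite ler_pM2r ?mulr_gt0 //; apply: ler_wpM2l; last by rewrite ler_pM2l.
    by rewrite mulr_ge0 // ltW.
  have -> : 2 * mu * (3 * (3 ^+ i * s')) * (2 * k%:R) =
      delta * (c * (4 * k%:R * (3 * 3 ^+ i))).
    by transitivity (mu * s' * (4 * k%:R * (3 * 3 ^+ i)));
      [ring|rewrite mus'; ring].
  apply: ler_piMr; first exact: ltW.
  rewrite -[leRHS]cE ler_pM2l // -[leRHS]mulrA ler_pM2l ?mulr_gt0 //.
  by apply: le_trans iQ _; rewrite ler_peMl ?exprn_ge0.
- have -> : mu * s' ^+ 2 = c * delta * s' by rewrite expr2 mulrA mus'.
  have p0 : 0 < 2 ^+ k :> R by rewrite exprn_gt0.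
  have cd : 0 < c * delta by rewrite mulr_gt0.
  apply: (@le_trans _ _ (2 * (c * delta * D i.+1 / (2 * 2 ^+ k)))); last first.
    have -> : 2 * (c * delta * D i.+1 / (2 * 2 ^+ k)) =
      (c * delta) * (D i.+1 / 2 ^+ k) by field; rewrite gt_eqF.
    by rewrite ler_pM2l // ler_pdivrMr.
  rewrite [leRHS]mulr_natl mulr2n; apply: lerD.
    rewrite ler_pM2r ?invr_gt0 ?mulr_gt0 //.
    by rewrite expr2 mulrA ler_pM2l.
  by apply/ltW/rounding_error_lt; rewrite ?e0.
- apply: (batch_size _ _ ltik _ MK); apply: le_trans mr _.
  by rewrite ler_pM2l // ler_peMl ?K1 // ltW.
- move=> a' w' v' aC' vB' ww'.
  apply: (@solvableS _ _ _ _ _ _ (1 + i.+1%:R / k%:R)).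
    by rewrite -addrA lerD2l -natr1 mulrDl lerD2l ler_pdivlMr.
  apply: (IH _ _ _ _ s') => //; first by rewrite addSnnS.
    by rewrite Ds' s'D.
  move=> j; have /andP[w1 w2] := ww' j; have /andP[w4 w5] := wm j.
  by rewrite (le_trans w4 w1) (le_trans w2) // exprS -mulrA ler_pM2l.
Qed.

End Schedule.

(** * The algorithm on the unit cube *)

Section CubeAlgorithm.
Variables (R : realType) (d k : nat).
Hypotheses (d_ge2 : (2 <= d)%N) (k_gt0 : (0 < k)%N).

Definition ratio : R := 2 * d%:R / (d%:R + 1).

(** The exponent of the constrained bound; the unconstrained one is twice it. *)
Definition rate : R :=
  - ((d%:R - 1) / (2 * (ratio ^+ k - 1))) - (d%:R - 1) / 2.

Let d2 : 2 <= d%:R :> R. Proof. by rewrite ler_nat. Qed.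

Lemma ratio_gt1 : 1 < ratio.
Proof. by rewrite ltr_pdivlMr; have := d2; lra. Qed.

Lemma ratioX_gt1 : 0 < ratio ^+ k - 1.
Proof. by rewrite subr_gt0 exprn_egt1 ?ratio_gt1 // -lt0n. Qed.

Lemma schedule_exists (delta : R) : 0 < delta <= 1 ->
  exists D rho tau : nat -> R,
  [/\ D 0%N = 1 /\ D k = delta,
      forall i, (i <= k)%N -> delta <= D i,
      (forall i, 1 <= rho i) /\ (forall i, (i < k)%N -> 1 <= tau i),
      (forall i, D i.+1 * rho i = D i) /\
      (forall i, tau i ^+ 2 * (delta * D i.+1) = D i ^+ 2) &
      forall i, rho i * tau i ^+ d.-1 = delta `^ rate].
Proof.
move=> /andP[de0 de1]; have r1 := ratio_gt1; have rk := ratioX_gt1.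
have d_ge := d2; have r0 : 0 < ratio by lra.
have de_neq0 : delta != 0 by rewrite gt_eqF.
have powD p q : delta `^ (p + q) = delta `^ p * delta `^ q.
  by rewrite powRD // de_neq0 implybT.
have powX p n : (delta `^ p) ^+ n = delta `^ (p * n%:R).
  by rewrite powRrM powR_mulrn // powR_ge0.
have pow_ge1 p : p <= 0 -> 1 <= delta `^ p.
  by move=> p0; rewrite -(powRr0 delta) ger_powR // de0.
have delta1 : delta = delta `^ 1 by rewrite powRr1 // ltW.
pose a i : R := (ratio ^+ i - 1) / (ratio ^+ k - 1).
have a_mono i j : (i <= j)%N -> a i <= a j.
  move=> ij; rewrite ler_pM2r ?invr_gt0 // lerD2r.
  by apply: ler_weXn2l => //; exact: ltW.
have ak : a k = 1 by rewrite /a divff // gt_eqF.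
have a1 i : (i <= k)%N -> a i <= 1 by move=> /a_mono; rewrite ak.
exists (fun i => delta `^ a i), (fun i => delta `^ (a i - a i.+1)),
  (fun i => delta `^ (a i - (1 + a i.+1) / 2)); split.
- by rewrite ak powRr1 ?ltW // /a expr0 subrr mul0r powRr0.
- by move=> i /a1 ai; rewrite {1}delta1 ger_powR // de0.
- split=> [i|i ik]; apply: pow_ge1; have := a_mono i i.+1 (leqnSn i).
    by lra.
  by have := a1 _ ik; lra.
- split=> i; first by rewrite -powD; congr (_ `^ _); ring.
  have -> : delta * delta `^ a i.+1 = delta `^ (1 + a i.+1).
    by rewrite powD -delta1.
  by rewrite !powX -!powD; congr (_ `^ _); field.
- move=> i; rewrite powX -powD; congr (_ `^ _).
  have -> : d.-1%:R = d%:R - 1 :> R by rewrite -subn1 natrB // ltnW.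
  rewrite /a /rate exprS; set z := ratio ^+ i.
  have rkn : ratio ^+ k - 1 != 0 by rewrite gt_eqF.
  set y := ratio ^+ k in rkn *; rewrite /ratio; field.
  by rewrite rkn gt_eqF //; lra.
Qed.

(** The box is the whole cube, whose relative boundary is empty: the certificate
    holds at the start for every objective. *)
Lemma cube_algorithm : exists2 C : R, 0 <= C &
  forall delta : R, 0 < delta <= 1 ->
    solvable k (C * delta `^ rate) delta 1 (delta ^+ 2)
      (0 : 'rV[R]_d) (const_mx 1) (const_mx 2^-1).
Proof.
have d0 : (0 < d)%N by exact: leq_trans d_ge2.
have kR : 0 < k%:R :> R by rewrite ltr0n.
have den1 : 1 <= 4 * k%:R * d%:R * 3 ^+ k :> R.
  by rewrite -!natrM -natrX -natrM ler1n !muln_gt0 k_gt0 d0 expn_gt0.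
have c1 : penalty_const R d k <= 1 by rewrite invf_le1 // (lt_le_trans ltr01).
have c0 : 0 <= penalty_const R d k by rewrite invr_ge0 (le_trans ler01).
exists (batch_const R d k).
  by rewrite mulr_ge0 // exprn_ge0 // mulr_ge0 // addr_ge0 // divr_ge0 // !mulr_ge0 // exprn_ge0.
move=> delta de01; have /andP[de0 de1] := de01.
have [D [rho [tau [[D0 Dk] Dge [rho1 tau1] [rhoE tauE] XE]]]] :=
  schedule_exists de01.
have slack1 : slack_at d k delta <= delta ^+ 2.
  have p1 : 1 <= 2 ^+ k :> R by rewrite exprn_ege1 // ler1n.
  rewrite ler_pdivrMr; last by lra.
  by have := sqr_ge0 delta; set e := delta ^+ 2; nra.
have [] := @schedule_solvable R d k delta (delta `^ rate) D rho tau d0 k_gt0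
  de0 Dk Dge (fun i _ => rho1 i) tau1 rhoE tauE XE k.-1 0 0 (const_mx 1)
  (const_mx 2^-1) 1.
- by rewrite add0n prednK.
- by move=> j; rewrite !mxE add0r.
- by move=> j; rewrite !mxE add0r; lra.
- by rewrite D0 expr0 divr1 !lexx.
- by move=> j; rewrite !mxE expr0 mul1r lexx.
rewrite prednK // !mul0r subr0 mulr1 addr0 => A AP; exists A => phi g dphi bnd.
have [|Ab Ain Akkt Aval] := AP phi g dphi.
  move=> x _ [j]; rewrite !mxE add0r eqxx => -[[_]|[_]] //.
  by rewrite eqxx.
split=> //.
by apply: le_trans Aval _; rewrite lerD2l.
Qed.

End CubeAlgorithm.

(** * Quadratic upper bounds from Lipschitz gradients *)

(** The mean value inequality from derivatives that are relative to [0, 1], hence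
    one-sided at the endpoints.  The set of t for which phi stays below the line
    of slope B + e is closed under suprema and can be extended past any t < 1. *)
Lemma mean_slope_le (R : realType) (phi psi : R -> R) (B : R) :
  (forall t e, 0 <= t <= 1 -> 0 < e -> exists2 r, 0 < r &
     forall s, 0 <= s <= 1 -> `|s - t| < r ->
       `|phi s - phi t - psi t * (s - t)| <= e * `|s - t|) ->
  (forall t, 0 <= t <= 1 -> psi t <= B) ->
  phi 1 - phi 0 <= B.
Proof.
move=> dphi psiB; rewrite leNgt; apply/negP => Blt.
pose e := (phi 1 - phi 0 - B) / 2; have e0 : 0 < e by rewrite /e; lra.
pose S := [set t : R | 0 <= t <= 1 /\ phi t <= phi 0 + (B + e) * t].
have S0 : S 0 by split; [rewrite lexx ler01|lra].
have Sub : ubound S 1 by move=> t [/andP[]].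
have supS : has_sup S by split; [exists 0|exists 1].
set s := sup S.
have s0 : 0 <= s by exact: sup_upper_bound supS _ S0.
have s1 : s <= 1 by exact: ge_sup supS.1 Sub.
have s01 : 0 <= s <= 1 by rewrite s0 s1.
have [r r0 near_s] := dphi s e s01 e0; have psis := psiB s s01.
have Ss : S s.
  split=> //; have [t [/andP[t0 t1] phit] st] := sup_adherent r0 supS.
  have ts : t <= s by apply: (sup_upper_bound supS); split; rewrite ?t0.
  have := near_s t; rewrite t0 t1 (ler0_norm (_ : t - s <= 0)); last by lra.
  move=> /(_ isT); rewrite -/s in st; have -> : - (t - s) < r by lra.
  move=> /(_ isT); rewrite ler_norml => /andP[nl nr].
  by nra.
have [s_lt1|] := ltP s 1; last first.
  move=> s_ge1; have s_eq1 : s = 1 by lra.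
  by case: Ss; rewrite s_eq1 /e; lra.
pose t := Num.min 1 (s + r / 2).
have st : s < t by rewrite lt_min s_lt1 /=; lra.
have tr : t <= s + r / 2 by rewrite ge_min lexx orbT.
have t1 : t <= 1 by rewrite ge_min lexx.
have := near_s t; rewrite (ltW (le_lt_trans s0 st)) t1 ger0_norm; last by lra.
move=> /(_ isT); have -> : t - s < r by lra.
move=> /(_ isT); rewrite ler_norml => /andP[nl nr].
suff /(sup_upper_bound supS) : S t by rewrite -/s leNgt st.
split; first by rewrite t1 andbT ltW // (le_lt_trans s0 st).
by have [_] := Ss; nra.
Qed.

Section LipschitzGradient.
Variables (R : realType) (d : nat).
Implicit Types (x y u v : 'rV[R]_d).

Lemma enormE v : enorm v = Num.sqrt (sqnorm v).
Proof. by []. Qed.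

Lemma enorm_sq v : enorm v ^+ 2 = sqnorm v.
Proof. by rewrite enormE sqr_sqrtr // sqnorm_ge0. Qed.

Lemma enorm_ge0 v : 0 <= enorm v.
Proof. exact: sqrtr_ge0. Qed.

Lemma sqnormZ (t : R) v : sqnorm (t *: v) = t ^+ 2 * sqnorm v.
Proof. by rewrite /sqnorm mulr_sumr; apply: eq_bigr => i _; rewrite mxE exprMn. Qed.

Lemma enormZ (t : R) v : enorm (t *: v) = `|t| * enorm v.
Proof. by rewrite !enormE sqnormZ sqrtrM ?sqr_ge0 // sqrtr_sqr. Qed.

Lemma enorm_le_coord (e : R) v : (0 < d)%N -> (forall j, `|v 0 j| <= e) ->
  enorm v <= d%:R * e.
Proof.
move=> d0 ve; have e0 : 0 <= e by exact: le_trans (ve (Ordinal d0)).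
have d1 : 1 <= d%:R :> R by rewrite ler1n.
have de0 : 0 <= d%:R * e by rewrite mulr_ge0.
rewrite -(@ler_pXn2r _ 2) ?nnegrE ?enorm_ge0 // enorm_sq.
apply: (@le_trans _ _ (d%:R * e ^+ 2)).
  rewrite mulr_natl -[X in _ *+ X]card_ord -sumr_const; apply: ler_sum => j _.
  by rewrite -real_normK ?num_real // lerXn2r // nnegrE.
by rewrite exprMn ler_wpM2r ?sqr_ge0 // expr2 ler_peMl.
Qed.

(** Cauchy-Schwarz in its additive form: 2 L u_i v_i <= u_i^2 + L^2 v_i^2. *)
Lemma dot_le_sqnorm (L : R) u v : 0 < L -> sqnorm u <= L ^+ 2 * sqnorm v ->
  dot u v <= L * sqnorm v.
Proof.
move=> L0 uv; rewrite -(ler_pM2l (mulr_gt0 (ltr0n R 2) L0)).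
have amgm : 2 * L * dot u v <= sqnorm u + L ^+ 2 * sqnorm v.
  rewrite /dot /sqnorm !mulr_sumr -big_split /=; apply: ler_sum => i _.
  by have := sqr_ge0 (u 0 i - L * v 0 i); nra.
have -> : 2 * L * (L * sqnorm v) = 2 * (L ^+ 2 * sqnorm v) by ring.
by lra.
Qed.

Lemma dotBl u v x : dot (u - v) x = dot u x - dot v x.
Proof. by rewrite /dot -sumrB; apply: eq_bigr => i _; rewrite !mxE mulrBl. Qed.

Lemma dotZr (t : R) u v : dot u (t *: v) = t * dot u v.
Proof. by rewrite /dot mulr_sumr; apply: eq_bigr => i _; rewrite mxE mulrCA. Qed.

Lemma dotZl (t : R) u v : dot (t *: u) v = t * dot u v.
Proof. by rewrite /dot mulr_sumr; apply: eq_bigr => i _; rewrite mxE mulrA. Qed.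

(** The mean value inequality on the segment from x to y; bounding the gradient
    variation by its largest value gives the constant L instead of L/2. *)
Lemma lipschitz_descent (dom : set 'rV[R]_d) (L : R) (f : 'rV[R]_d -> R)
    (G : 'rV[R]_d -> 'rV[R]_d) x y :
  0 < L -> (forall z, dom z -> is_gradient_in dom f z (G z)) ->
  (forall u v, dom u -> dom v -> enorm (G u - G v) <= L * enorm (u - v)) ->
  (forall t, 0 <= t <= 1 -> dom (x + t *: (y - x))) ->
  f y <= f x + dot (G x) (y - x) + L * sqnorm (y - x).
Proof.
move=> L0 Ggrad Glip seg; set v := y - x in seg *.
pose p t := x + t *: v.
have pB s t : p s - p t = (s - t) *: v.
  by rewrite /p opprD addrACA subrr add0r scalerBl.
have p0 : p 0 = x by rewrite /p scale0r addr0.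
have p1 : p 1 = y by rewrite /p scale1r addrC subrK.
suff : f (p 1) - f (p 0) <= dot (G x) v + L * sqnorm v by rewrite p0 p1; lra.
apply: (@mean_slope_le _ (f \o p) (fun t => dot (G (p t)) v)) => [t e t01 e0|t t01].
  have e'0 : 0 < e / (enorm v + 1) by rewrite divr_gt0 // ltr_wpDl ?enorm_ge0.
  have /nbhs_ballP[r /= r0 rP] := Ggrad _ (seg _ t01) _ e'0.
  exists (r / (`|v| + 1)); first by rewrite divr_gt0 // ltr_wpDl.
  move=> s s01 st; have /rP : ball (p t) r (p s).
    rewrite -ball_normE /ball_ /= distrC pB normrZ.
    rewrite ltr_pdivlMr ?ltr_wpDl // in st; apply: le_lt_trans st.
    by rewrite ler_wpM2l // lerDl.
  move=> /(_ (seg _ s01)); rewrite pB dotZr enormZ /= [_ * (s - t)]mulrC.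
  move=> /le_trans; apply; rewrite mulrCA [leRHS]mulrC ler_wpM2l //.
  rewrite -mulrA ler_piMr ?(ltW e0) // mulrC ler_pdivrMr ?ltr_wpDl ?enorm_ge0 //.
  by rewrite mul1r lerDl.
have x01 : dom x by rewrite -p0; apply: seg; rewrite lexx ler01.
have := @dot_le_sqnorm L (G (p t) - G x) v L0; rewrite dotBl => h.
suff /h : sqnorm (G (p t) - G x) <= L ^+ 2 * sqnorm v by lra.
rewrite -!enorm_sq -exprMn.
apply: lerXn2r; rewrite ?nnegrE ?mulr_ge0 ?enorm_ge0 ?(ltW L0) //.
apply: le_trans (Glip _ _ (seg _ t01) x01) _; rewrite ler_pM2l //.
have -> : x + t *: v - x = t *: v by rewrite addrAC subrr add0r.
rewrite enormZ ler_piMl ?enorm_ge0 //.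
by have /andP[t0 t1] := t01; rewrite ger0_norm.
Qed.

Lemma descent_scale (K c : R) (phi : 'rV[R]_d -> R) (g : 'rV[R]_d -> 'rV[R]_d) :
  0 < c -> descent K phi g ->
  descent (K / c) (fun x => phi x / c) (fun x => c^-1 *: g x).
Proof.
move=> c0 dphi x y xC yC; rewrite dotZl.
have -> : phi x / c + c^-1 * dot (g x) (y - x) + K / c * sqnorm (y - x) =
  (phi x + dot (g x) (y - x) + K * sqnorm (y - x)) / c by ring.
by rewrite ler_pM2r ?invr_gt0 //; exact: dphi.
Qed.

Lemma cube_segment x y (t : R) : unit_cube x -> unit_cube y -> 0 <= t <= 1 ->
  unit_cube (x + t *: (y - x)).
Proof.
move=> xC yC /andP[t0 t1] j; rewrite !mxE.
by have := xC j; have := yC j; nra.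
Qed.

Lemma proj_gradZ (c : R) x v : 0 < c ->
  proj_grad x (c^-1 *: v) = c^-1 *: proj_grad x v.
Proof.
move=> c0; have ci0 : 0 <= c^-1 by rewrite invr_ge0 ltW.
apply/rowP => j; rewrite !mxE; case: ifP => _; last case: ifP => _ //.
  by rewrite minr_pMr // mulr0.
by rewrite maxr_pMr // mulr0.
Qed.

End LipschitzGradient.

(** * Reduction to the unit cube *)

Section Reductions.
Variables (R : realType) (d k : nat) (L : R).
Hypotheses (d_ge2 : (2 <= d)%N) (k_gt0 : (0 < k)%N) (L0 : 0 < L).

Let d1 : 1 <= d%:R :> R. Proof. by rewrite ler1n ltnW. Qed.
Let d0 : 0 < d%:R :> R. Proof. exact: lt_le_trans ltr01 d1. Qed.

Local Notation rate := (rate R d k).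

(** Coordinatewise accuracy eps / d bounds the Euclidean norm by eps.  The cap
    at 1 on delta is why the bound has a maximum with 1. *)
Lemma constrained_algorithm : exists C : R, forall eps : R, 0 < eps ->
  exists A : algorithm R d,
    forall (f : 'rV[R]_d -> R) (G : 'rV[R]_d -> 'rV[R]_d),
      smooth_on_cube L f G ->
      (forall j : nat, (j < k)%N ->
         (forall x, x \in batch A f j -> unit_cube x) /\
         (size (batch A f j))%:R <= C * Num.max 1 (eps `^ rate)) /\
      kkt eps G (output A f k).
Proof.
have [C C0 cubeA] := cube_algorithm R d_ge2 k_gt0.
have Ld0 : 0 < L * d%:R by rewrite mulr_gt0.
exists (C * (1 + (L * d%:R)^-1 `^ rate)) => eps eps0.
pose delta := Num.min 1 (eps / (L * d%:R)).
have de0 : 0 < delta by rewrite lt_min ltr01 divr_gt0.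
have de01 : 0 < delta <= 1 by rewrite de0 ge_min lexx.
have [A AP] := cubeA delta de01.
exists (simulate A id (fun _ z => z / L)) => f G [Ggrad Glip].
have df : descent L f G.
  move=> x y xC yC; apply: lipschitz_descent L0 Ggrad Glip _ => t.
  exact: cube_segment.
have /(descent_scale L0) := df; rewrite divff ?gt_eqF // => /AP[].
  move=> x _ [j]; rewrite !mxE add0r eqxx => -[[_]|[_]] //.
  by rewrite eqxx.
have FE x : f x / L = f (id x) / L by [].
set F := (fun x => f x / L) => Abatch Abox Akkt _; split=> [j jk|].
  rewrite (batch_simulate A j FE) map_id; have [AC Asz] := Abatch j jk.
  split=> //; apply: le_trans Asz _; rewrite -mulrA ler_wpM2l //.
  have w0 : 0 <= (L * d%:R)^-1 `^ rate by exact: powR_ge0.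
  rewrite /delta minElt; case: ifP => _.
    by rewrite powR1 mulr_ege1 ?lerDl // le_max lexx.
  rewrite powRM ?invr_ge0 ?(ltW eps0) ?(ltW Ld0) // mulrC.
  by apply: ler_pM; rewrite ?powR_ge0 ?lerDr // le_max lexx orbT.
rewrite (output_simulate A k FE); change (id ?y) with y; split.
  move=> j; have := Abox j; rewrite !mxE add0r; exact.
set y := output A F k in Akkt *.
have dE : eps = d%:R * (eps / d%:R) by rewrite mulrC divfK // gt_eqF.
rewrite dE; apply: enorm_le_coord => [|j]; first exact: ltnW.
have := Akkt j; rewrite proj_gradZ // mxE normrM gtr0_norm ?invr_gt0 //.
rewrite mulrC ler_pdivrMr // => /le_trans; apply.
apply: (@le_trans _ _ (eps / (L * d%:R) * L)).
  by rewrite ler_pM2r // ge_min lexx orbT.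
by rewrite le_eqVlt; apply/orP; left; apply/eqP; field; rewrite !gt_eqF.
Qed.

Lemma smooth_descent (f : 'rV[R]_d -> R) x y : smooth L f ->
  f y <= f x + dot (grad f x) (y - x) + L * sqnorm (y - x).
Proof.
move=> [fdiff flip]; apply: (@lipschitz_descent _ _ setT) L0 _ _ _ => //.
by move=> z _; exact: differentiable_is_gradient_in.
Qed.

(** A gradient step of length 1/(2L) from x0 decreases f by |grad f x0|^2 / (4L),
    and no decrease can exceed Delta.  So for large eps no query is needed. *)
Lemma stationary_of_small_gap (Delta eps : R) (f : 'rV[R]_d -> R)
    (x0 : 'rV[R]_d) :
  0 < eps -> 4 * L * Delta <= eps ^+ 2 -> smooth L f ->
  (forall x, f x0 <= f x + Delta) -> stationary eps f x0.
Proof.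
move=> eps0 gap fs fmin; rewrite /stationary.
pose g := grad f x0; pose y := x0 + (- (2 * L)^-1) *: g.
have := smooth_descent x0 y fs.
have -> : y - x0 = (- (2 * L)^-1) *: g by rewrite /y addrAC subrr add0r.
rewrite sqnormZ dotZr -/g -[dot g g]/(\sum_i g 0 i * g 0 i).
have -> : \sum_i g 0 i * g 0 i = sqnorm g.
  by apply: eq_bigr => i _; rewrite expr2.
move=> fy; have {fy} := le_trans (fmin y) (lerD fy (lexx Delta)).
have -> : f x0 + - (2 * L)^-1 * sqnorm g + L * ((- (2 * L)^-1) ^+ 2 * sqnorm g)
    + Delta = f x0 + Delta - sqnorm g / (4 * L) by field; rewrite gt_eqF.
move=> fg; have : sqnorm g / (4 * L) <= Delta by lra.
rewrite ler_pdivrMr ?mulr_gt0 // mulrC => /le_trans /(_ gap).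
rewrite -enorm_sq ler_pXn2r ?nnegrE ?enorm_ge0 //; exact: ltW.
Qed.

(** The penalty is 4 Delta on the boundary of the cube of radius r around x0 and
    its gradient there is eps / (2d) per coordinate.  The penalized objective
    at the output is at most f x0 + Delta, hence its penalty is below 4 Delta:
    the output is interior, where the projected gradient is the gradient. *)
Lemma unconstrained_algorithm (Delta : R) : 0 <= Delta ->
  exists C : R, forall eps : R, 0 < eps ->
    exists A : 'rV[R]_d -> algorithm R d,
      forall (f : 'rV[R]_d -> R) (x0 : 'rV[R]_d),
        smooth L f -> has_lbound (range f) ->
        f x0 - inf (range f) <= Delta ->
        (forall j : nat, (j < k)%N ->
           (size (batch (A x0) f j))%:R <= C * eps `^ (2 * rate)) /\
        stationary eps f (output (A x0) f k).
Proof.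
move=> Delta0; have [C C0 cubeA] := cube_algorithm R d_ge2 k_gt0.
exists (C * (128 * d%:R ^+ 2 * Delta * L)^-1 `^ rate) => eps eps0.
have inf_le (f : 'rV[R]_d -> R) x : has_lbound (range f) -> inf (range f) <= f x.
  by move=> lbf; apply: ge_inf => //; exists x.
have [gap|gap] := leP (4 * L * Delta) (eps ^+ 2).
  exists (fun x0 => Algorithm (fun=> [::]) (fun=> x0)) => f x0 fs lbf fD.
  split=> [j _|].
    by rewrite mulr_ge0 ?powR_ge0 // mulr_ge0 ?powR_ge0.
  apply: stationary_of_small_gap gap fs _ => // x.
  by have := inf_le f x lbf; lra.
have Dpos : 0 < Delta.
  rewrite lt_neqAle Delta0 andbT; apply: contraTneq gap => <-.
  by rewrite mulr0 -leNgt sqr_ge0.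
pose den := 128 * d%:R ^+ 2 * Delta * L.
have den0 : 0 < den by rewrite !mulr_gt0 // exprn_gt0.
pose delta := eps ^+ 2 / den.
have de0 : 0 < delta by rewrite divr_gt0 // exprn_gt0.
have dd1 : 1 <= d%:R ^+ 2 :> R by rewrite exprn_ege1.
have LD0 : 0 < L * Delta by rewrite mulr_gt0.
have de1 : delta <= 1.
  rewrite ler_pdivrMr // mul1r; apply/ltW/(lt_le_trans gap).
  rewrite /den; have -> : 128 * d%:R ^+ 2 * Delta * L =
    d%:R ^+ 2 * (128 * (L * Delta)) by ring.
  by rewrite -mulrA; set z := L * Delta in LD0 *; nra.
have de01 : 0 < delta <= 1 by rewrite de0.
have [A AP] := cubeA delta de01.
(* r and mu solve mu * r = eps / (4 d), for the gradient of the penalty, and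
   mu * r ^+ 2 = 4 Delta, for its value on the boundary *)
pose r := 16 * d%:R * Delta / eps.
have r0 : 0 < r by rewrite !mulr_gt0 // invr_gt0.
have rE : r = 16 * d%:R * Delta / eps by [].
clearbody r.
pose mu := eps / (4 * d%:R * r).
have mu0 : 0 < mu by rewrite divr_gt0 // !mulr_gt0.
have muE : mu * r = eps / (4 * d%:R).
  by rewrite /mu; field; rewrite !gt_eqF.
have mur2 : mu * r ^+ 2 = 4 * Delta.
  by rewrite expr2 mulrA muE rE; field; rewrite !gt_eqF.
have muL : mu <= L.
  have muD : mu * (64 * d%:R ^+ 2 * Delta) = eps ^+ 2.
    by rewrite /mu rE; field; rewrite !gt_eqF.
  have D64 : 0 < 64 * d%:R ^+ 2 * Delta by rewrite !mulr_gt0 // exprn_gt0.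
  rewrite -(ler_pM2r D64) muD; apply/ltW/(lt_le_trans gap).
  have -> : L * (64 * d%:R ^+ 2 * Delta) = d%:R ^+ 2 * (64 * (L * Delta)).
    by ring.
  by rewrite -mulrA; set z := L * Delta in LD0 *; nra.
pose Lam := 4 * r ^+ 2 * (L + mu).
have Lam0 : 0 < Lam by rewrite !mulr_gt0 ?exprn_gt0 ?addr_gt0.
pose center : 'rV[R]_d := const_mx 2^-1.
pose psi x0 u : 'rV[R]_d := x0 + (2 * r) *: (u - center).
pose pen u := 4 * r ^+ 2 * mu * sqnorm (u - center).
exists (fun x0 => simulate A (psi x0) (fun u z => (z + pen u) / Lam)).
move=> f x0 fs lbf fD.
have psiB u u' : psi x0 u' - psi x0 u = (2 * r) *: (u' - u).
  rewrite /psi opprD addrACA subrr add0r -scalerBr; congr (_ *: _).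
  by rewrite opprB addrA subrK.
have dfpsi : descent (4 * r ^+ 2 * L) (f \o psi x0)
    (fun u => (2 * r) *: grad f (psi x0 u)).
  move=> u u' _ _ /=.
  have := smooth_descent (psi x0 u) (psi x0 u') fs.
  rewrite psiB sqnormZ dotZr dotZl exprMn => /le_trans; apply.
  by rewrite le_eqVlt; apply/orP; left; apply/eqP; ring.
have := descent_scale Lam0 (descent_add_sqnorm (4 * r ^+ 2 * mu) center dfpsi).
rewrite -mulrDr divff ?gt_eqF // => /AP[].
  move=> x _ [j]; rewrite !mxE add0r eqxx => -[[_]|[_]] //.
  by rewrite eqxx.
have FE u : (f (psi x0 u) + pen u) / Lam = (f (psi x0 u) + pen u) / Lam by [].
set F := (fun u => (f (psi x0 u) + pen u) / Lam) in FE.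
rewrite -/F => Abatch Abox Akkt Aval; split=> [j jk|].
  rewrite (batch_simulate A j FE) size_map; have [_ Asz] := Abatch j jk.
  apply: le_trans Asz _; rewrite -mulrA ler_wpM2l // mulrC.
  rewrite /delta powRM ?sqr_ge0 ?invr_ge0 ?(ltW den0) //.
  by rewrite powRrM powR_mulrn ?(ltW eps0).
rewrite (output_simulate A k FE).
set u := output A F k in Akkt Aval Abox *.
have psic : psi x0 center = x0 by rewrite /psi subrr scaler0 addr0.
have penc : pen center = 0.
  rewrite /pen subrr /sqnorm big1 ?mulr0 // => i _; by rewrite mxE expr0n.
have Lam_le : Lam <= 8 * r ^+ 2 * L.
  have r20 : 0 < 4 * r ^+ 2 by rewrite mulr_gt0 // exprn_gt0.
  have -> : 8 * r ^+ 2 * L = 4 * r ^+ 2 * (L + L) by ring.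
  by rewrite /Lam ler_pM2l // lerD2l.
have LamD : Lam * delta ^+ 2 <= Delta.
  apply: (@le_trans _ _ (8 * r ^+ 2 * L * delta ^+ 2)).
    by rewrite ler_wpM2r // sqr_ge0.
  have -> : 8 * r ^+ 2 * L * delta ^+ 2 = eps ^+ 2 / (8 * d%:R ^+ 2 * L).
    by rewrite rE /delta /den; field; rewrite !gt_eqF.
  rewrite ler_pdivrMr ?mulr_gt0 ?exprn_gt0 //; apply/ltW/(lt_le_trans gap).
  have -> : Delta * (8 * d%:R ^+ 2 * L) = d%:R ^+ 2 * (8 * (L * Delta)) by ring.
  by rewrite -mulrA; set z := L * Delta in LD0 *; nra.
have low : pen u < 4 * Delta.
  have FC : F center = f x0 / Lam by rewrite /F psic penc addr0.
  have : F u <= F center + delta ^+ 2 := Aval.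
  rewrite FC /F ler_pdivrMr // mulrDl divfK ?gt_eqF //.
  rewrite mulrC in LamD; have := inf_le f (psi x0 u) lbf; lra.
have u_int j : 0 < u 0 j < 1.
  have far : (u 0 j - 2^-1) ^+ 2 < 2^-1 ^+ 2.
    have := sqnorm_ge_coord (u - center) j; rewrite !mxE => uj.
    have r20 : 0 < 4 * (mu * r ^+ 2) by rewrite mur2 !mulr_gt0.
    apply: le_lt_trans uj _; rewrite -(ltr_pM2l r20).
    move: low; rewrite /pen -mur2; lra.
  by apply/andP; split; nra.
have dE : eps = d%:R * (eps / d%:R) by rewrite mulrC divfK // gt_eqF.
rewrite /stationary dE; apply: enorm_le_coord => [|j]; first exact: ltnW.
have /andP[u0 u1] := u_int j; have := Akkt j.
move: (grad f (psi x0 u)) => v.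
rewrite !mxE (gt_eqF u0) (lt_eqF u1) normrM gtr0_norm ?invr_gt0 //.
rewrite mulrC ler_pdivrMr //.
have -> : 2 * r * v 0 j + 2 * (4 * r ^+ 2 * mu) * (u 0 j - 2^-1) =
    2 * r * (v 0 j + 4 * (mu * r) * (u 0 j - 2^-1)) by ring.
have r2 : 0 < 2 * r by rewrite mulr_gt0.
have dLam : delta * Lam <= 2 * r * (eps / d%:R / 2).
  apply: (@le_trans _ _ (delta * (8 * r ^+ 2 * L))); first by rewrite ler_pM2l.
  rewrite le_eqVlt; apply/orP; left; apply/eqP.
  by rewrite rE /delta /den; field; rewrite !gt_eqF.
move=> /le_trans /(_ dLam); rewrite normrM gtr0_norm // ler_pM2l // muE.
have -> : 4 * (eps / (4 * d%:R)) = eps / d%:R by field; rewrite gt_eqF.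
have : 0 < eps / d%:R by rewrite divr_gt0.
set e := eps / d%:R => e0; rewrite !ler_norml => /andP[lo hi].
by apply/andP; split; nra.
Qed.

End Reductions.

Unset Implicit Arguments.

Theorem theorem10 (R : realType) (d k : nat) (L : R)
    (hd : (2 <= d)%N) (hk : (1 <= k)%N) (hL : 0 < L) :
  (forall Delta : R, 0 <= Delta ->
     exists C1 : R, forall eps : R, 0 < eps ->
       exists A : 'rV[R]_d -> algorithm R d,
         forall (f : 'rV[R]_d -> R) (x0 : 'rV[R]_d),
           smooth L f ->
           has_lbound (range f) ->
           f x0 - inf (range f) <= Delta ->
           (forall j : nat, (j < k)%N ->
              (size (batch (A x0) f j))%:R <=
                C1 * eps `^ (- ((d%:R - 1) /
                                ((2 * d%:R / (d%:R + 1)) ^+ k - 1))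
                             - (d%:R - 1))) /\
           stationary eps f (output (A x0) f k)) /\
  (exists C2 : R, forall eps : R, 0 < eps ->
     exists A : algorithm R d,
       forall (f : 'rV[R]_d -> R) (G : 'rV[R]_d -> 'rV[R]_d),
         smooth_on_cube L f G ->
         (forall j : nat, (j < k)%N ->
            (forall x, x \in batch A f j -> unit_cube x) /\
            (size (batch A f j))%:R <=
              C2 * Num.max 1
                     (eps `^ (- ((d%:R - 1) /
                                 (2 * ((2 * d%:R / (d%:R + 1)) ^+ k - 1)))
                              - (d%:R - 1) / 2))) /\
         kkt eps G (output A f k)).
Proof.
have rk := ratioX_gt1 R hd hk; split => [Delta Delta0|].
  have rateE : 2 * rate R d k =
      - ((d%:R - 1) / ((2 * d%:R / (d%:R + 1)) ^+ k - 1)) - (d%:R - 1).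
    by rewrite /rate -/(ratio R d); field; rewrite gt_eqF.
  rewrite -rateE; exact: unconstrained_algorithm.
exact: constrained_algorithm.
Qed.
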